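(* If $\vdash\mathcal M:\mathsf G$, then $\mathcal M$ does not get stuck, i.e. there is no $\mathcal M'$ with $\mathcal M\longrightarrow^*\mathcal M'$ and $\mathcal M'$ stuck.
   Context: Calculus. Values are natural numbers $n$, integers $i$, and $\mathsf{true},\mathsf{false}$. Expressions: $e::=x\mid v\mid \mathsf{succ}\,e\mid \mathsf{neg}\,e\mid \neg e\mid e_1\oplus e_2\mid e_1>e_2$. Evaluation $e\downarrow v$ is the least relation such that: $\mathsf{succ}\,n\downarrow n+1$ (only for naturals $n$); $\mathsf{neg}\,i\downarrow -i$; $\neg\mathsf{true}\downarrow\mathsf{false}$, $\neg\mathsf{false}\downarrow\mathsf{true}$; $v\downarrow v$; $(i_1>i_2)\downarrow\mathsf{true}$ if $i_1>i_2$, $\downarrow\mathsf{false}$ otherwise; $e_1\oplus e_2\downarrow v$ if $e_1\downarrow v$ or $e_2\downarrow v$; if $e\downarrow v$ and $\mathcal E(v)\downarrow v'$ then $\mathcal E(e)\downarrow v'$ for any one-hole expression context $\mathcal E$. Processes: $P::=\mathsf p?\ell(x).P\mid \mathsf p!\ell(e).P\mid P+P\mid \mathsf{if}\ e\ \mathsf{then}\ P\ \mathsf{else}\ P\mid \mu X.P\mid X\mid \mathbf 0$ (guarded recursion; $\mu X.P$ identified with its unfolding). Sessions: $\mathcal M::=\mathsf p\lhd P\mid\mathcal M\mid\mathcal M$; $\sum$, $\prod$ denote iterated $+$, $\mid$. Structural congruence $\equiv$: $+$ commutative and associative; $P\equiv Q\Rightarrow\mathsf p\lhd P\equiv\mathsf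 p\lhd Q$; $\mathsf p\lhd\mathbf 0\mid\mathcal M\equiv\mathcal M$; $\mid$ commutative and associative. Reduction: $\mathsf p\lhd\sum_{i\in I}\mathsf q?\ell_i(x).P_i\mid\mathsf q\lhd\mathsf p!\ell_j(e).Q\longrightarrow\mathsf p\lhd P_j\{v/x\}\mid\mathsf q\lhd Q$ if $j\in I$, $e\downarrow v$; $\mathsf p\lhd\mathsf{if}\ e\ \mathsf{then}\ P\ \mathsf{else}\ Q\longrightarrow\mathsf p\lhd P$ if $e\downarrow\mathsf{true}$, $\longrightarrow\mathsf p\lhd Q$ if $e\downarrow\mathsf{false}$; closed under contexts $C::=[\cdot]\mid C\mid\mathcal M$ and under $\equiv$; $\longrightarrow^*$ its reflexive-transitive closure. A session $\mathcal M$ is stuck if $\mathcal M\not\equiv\mathsf p\lhd\mathbf 0$ for every $\mathsf p$ and there is no $\mathcal M'$ with $\mathcal M\longrightarrow\mathcal M'$. Types. Sorts $\mathtt{nat},\mathtt{int},\mathtt{bool}$ with $\leq:$ the reflexive-transitive closure of $\mathtt{nat}\leq:\mathtt{int}$. Global types $\mathsf G::=\mathsf p\to\mathsf q:\{\ell_i(S_i).\mathsf G_i\}_{i\in I}\mid\mu\mathbf t.\mathsf G\mid\mathbf t\mid\mathtt{end}$; session types $T::=\bigwedge_{i\in I}\mathsf p?\ell_i(S_i).T_i\mid\bigvee_{i\in I}\mathsf q!\ell_i(S_i).T_i\mid\mu\mathbf t.T\mid\mathbf t\mid\mathtt{end}$ (distinct labels, guarded recursion, regular-tree equality). Merge $T\sqcap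 T'$: $T$ if $T=T'$; $T\wedge T'$ if both are intersections of inputs from the same sender with disjoint label sets; undefined otherwise. Projection: $(\mathsf p\to\mathsf q:\{\ell_i(S_i).\mathsf G_i\}_{i\in I})\upharpoonright\mathsf r$ is $\bigvee_{i}\mathsf q!\ell_i(S_i).(\mathsf G_i\upharpoonright\mathsf r)$ if $\mathsf r=\mathsf p$, $\bigwedge_i\mathsf p?\ell_i(S_i).(\mathsf G_i\upharpoonright\mathsf r)$ if $\mathsf r=\mathsf q$, $\sqcap_i(\mathsf G_i\upharpoonright\mathsf r)$ (if defined) otherwise; $(\mu\mathbf t.\mathsf G)\upharpoonright\mathsf r=\mu\mathbf t.(\mathsf G\upharpoonright\mathsf r)$ if $\mathsf r$ occurs in $\mathsf G$, else $\mathtt{end}$; $\mathbf t\upharpoonright\mathsf r=\mathbf t$, $\mathtt{end}\upharpoonright\mathsf r=\mathtt{end}$. $\mathrm{pt}(\mathsf p\to\mathsf q:\{\ell_i(S_i).\mathsf G_i\})=\{\mathsf p,\mathsf q\}\cup\mathrm{pt}(\mathsf G_i)$, $\mathrm{pt}(\mu\mathbf t.\mathsf G)=\mathrm{pt}(\mathsf G)$, $\mathrm{pt}(\mathbf t)=\mathrm{pt}(\mathtt{end})=\emptyset$. Subtyping $\leqslant$: greatest relation with $\mathtt{end}\leqslant\mathtt{end}$; $\bigwedge_{i\in I\cup J}\mathsf p?\ell_i(S_i).T_i\leqslant\bigwedge_{i\in I}\mathsf p?\ell_i(S'_i).T'_i$ if $S'_i\leq:S_i$, $T_i\leqslant T'_i$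 for all $i\in I$; $\bigvee_{i\in I}\mathsf p!\ell_i(S_i).T_i\leqslant\bigvee_{i\in I\cup J}\mathsf p!\ell_i(S'_i).T'_i$ if $S_i\leq:S'_i$, $T_i\leqslant T'_i$ for all $i\in I$. Typing: expressions: $n:\mathtt{nat}$, $i:\mathtt{int}$, booleans $:\mathtt{bool}$, $\Gamma,x:S\vdash x:S$; $\mathsf{succ}$: $\mathtt{nat}\to\mathtt{nat}$; $\mathsf{neg}$: $\mathtt{int}\to\mathtt{int}$; $\neg$: $\mathtt{bool}\to\mathtt{bool}$; $e_1\oplus e_2:S$ if both $:S$; $e_1>e_2:\mathtt{bool}$ if both $:\mathtt{int}$; subsumption via $\leq:$. Processes: if $\Gamma,x:S_i\vdash P_i:T_i$ ($i\in I$) then $\Gamma\vdash\sum_{i\in I}\mathsf q?\ell_i(x).P_i:\bigwedge_{i\in I}\mathsf q?\ell_i(S_i).T_i$; $\Gamma\vdash\mathbf 0:\mathtt{end}$; $\Gamma\vdash e:S$, $\Gamma\vdash P:T$ give $\Gamma\vdash\mathsf q!\ell(e).P:\mathsf q!\ell(S).T$; $\Gamma\vdash e:\mathtt{bool}$, $\Gamma\vdash P_1:T_1$, $\Gamma\vdash P_2:T_2$ give $\Gamma\vdash\mathsf{if}\ e\ \mathsf{then}\ P_1\ \mathsf{else}\ P_2:T_1\vee T_2$; $\Gamma,X:T\vdash P:T$ gives $\Gamma\vdash\mu X.P:T$; $\Gamma,X:T\vdash X:T$; $\Gamma\vdash P:T$ and $T\leqslant T'$ give $\Gamma\vdash P:T'$.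 Sessions: if $\vdash P_i:\mathsf G\upharpoonright\mathsf p_i$ for all $i\in I$ and $\mathrm{pt}(\mathsf G)\subseteq\{\mathsf p_i\}_{i\in I}$ then $\vdash\prod_{i\in I}\mathsf p_i\lhd P_i:\mathsf G$.
   Formalization: In projecting μt.G on r, ''r occurs in G'' is read on the regular tree: a free variable of an enclosing recursion also counts; with the literal test the claim fails. Also assumed: p≠q in every p→q, and the participants p_i of a typed session are pairwise distinct. *)

(* Defs.v *)
(* Binders are de Bruijn indices: one index space for expression
   variables (bound by inputs), one for process variables (bound by mu), and one
   for type variables in each of the two type syntaxes. *)
From Stdlib Require Export ZArith List Permutation Relations.
Export ListNotations.

Definition participant := nat.
Definition label := nat.

(* ------------------------------ Expressions ------------------------------ *)

(* Natural numbers are integers: the numeral [n] is a natural number when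
   [0 <= n], so that [neg] and [>] also apply to naturals, as the subsorting
   nat <= int requires. *)
Inductive value :=
| VNum (i : Z)
| VBool (b : bool).

Inductive expr :=
| EVar (x : nat)
| EVal (v : value)
| ESucc (e : expr)
| ENeg (e : expr)
| ENot (e : expr)
| EChoice (e1 e2 : expr)
| EGt (e1 e2 : expr).

Inductive ectx :=
| CHole
| CSucc (E : ectx)
| CNeg (E : ectx)
| CNot (E : ectx)
| CChoiceL (E : ectx) (e : expr)
| CChoiceR (e : expr) (E : ectx)
| CGtL (E : ectx) (e : expr)
| CGtR (e : expr) (E : ectx).

Fixpoint fill (E : ectx) (e : expr) : expr :=
  match E with
  | CHole => e
  | CSucc E => ESucc (fill E e)
  | CNeg E => ENeg (fill E e)
  | CNot E => ENot (fill E e)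
  | CChoiceL E e2 => EChoice (fill E e) e2
  | CChoiceR e1 E => EChoice e1 (fill E e)
  | CGtL E e2 => EGt (fill E e) e2
  | CGtR e1 E => EGt e1 (fill E e)
  end.

Inductive eval : expr -> value -> Prop :=
| eval_succ n : (0 <= n)%Z -> eval (ESucc (EVal (VNum n))) (VNum (n + 1))
| eval_neg i : eval (ENeg (EVal (VNum i))) (VNum (- i))
| eval_not b : eval (ENot (EVal (VBool b))) (VBool (negb b))
| eval_val v : eval (EVal v) v
| eval_gt i1 i2 :
    eval (EGt (EVal (VNum i1)) (EVal (VNum i2))) (VBool (i1 >? i2)%Z)
| eval_choice_l e1 e2 v : eval e1 v -> eval (EChoice e1 e2) v
| eval_choice_r e1 e2 v : eval e2 v -> eval (EChoice e1 e2) v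
| eval_ctx E e v v' : eval e v -> eval (fill E (EVal v)) v' -> eval (fill E e) v'.

Fixpoint esubst (k : nat) (v : value) (e : expr) : expr :=
  match e with
  | EVar x => if x =? k then EVal v else if k <? x then EVar (pred x) else EVar x
  | EVal w => EVal w
  | ESucc e => ESucc (esubst k v e)
  | ENeg e => ENeg (esubst k v e)
  | ENot e => ENot (esubst k v e)
  | EChoice e1 e2 => EChoice (esubst k v e1) (esubst k v e2)
  | EGt e1 e2 => EGt (esubst k v e1) (esubst k v e2)
  end.

Fixpoint eshift (k : nat) (e : expr) : expr :=
  match e with
  | EVar x => if x <? k then EVar x else EVar (S x)
  | EVal w => EVal w
  | ESucc e => ESucc (eshift k e)
  | ENeg e => ENeg (eshift k e)
  | ENot e => ENot (eshift k e)
  | EChoice e1 e2 => EChoice (eshift k e1) (eshift k e2)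
  | EGt e1 e2 => EGt (eshift k e1) (eshift k e2)
  end.

(* ------------------------------- Processes ------------------------------- *)

Inductive proc :=
| PIn (p : participant) (l : label) (P : proc)   (* binds an expression variable *)
| POut (p : participant) (l : label) (e : expr) (P : proc)
| PSum (P Q : proc)
| PIf (e : expr) (P Q : proc)
| PMu (P : proc)                                 (* binds a process variable *)
| PVar (X : nat)
| PNil.

(* P{v/x} *)
Fixpoint vsubst (k : nat) (v : value) (P : proc) : proc :=
  match P with
  | PIn p l P => PIn p l (vsubst (S k) v P)
  | POut p l e P => POut p l (esubst k v e) (vsubst k v P)
  | PSum P Q => PSum (vsubst k v P) (vsubst k v Q)
  | PIf e P Q => PIf (esubst k v e) (vsubst k v P) (vsubst k v Q)
  | PMu P => PMu (vsubst k v P)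
  | PVar X => PVar X
  | PNil => PNil
  end.

(* shifts the expression variables of a process *)
Fixpoint vshift (k : nat) (P : proc) : proc :=
  match P with
  | PIn p l P => PIn p l (vshift (S k) P)
  | POut p l e P => POut p l (eshift k e) (vshift k P)
  | PSum P Q => PSum (vshift k P) (vshift k Q)
  | PIf e P Q => PIf (eshift k e) (vshift k P) (vshift k Q)
  | PMu P => PMu (vshift k P)
  | PVar X => PVar X
  | PNil => PNil
  end.

(* shifts the process variables of a process *)
Fixpoint pshift (k : nat) (P : proc) : proc :=
  match P with
  | PIn p l P => PIn p l (pshift k P)
  | POut p l e P => POut p l e (pshift k P)
  | PSum P Q => PSum (pshift k P) (pshift k Q)
  | PIf e P Q => PIf e (pshift k P) (pshift k Q)
  | PMu P => PMu (pshift (S k) P)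
  | PVar X => if X <? k then PVar X else PVar (S X)
  | PNil => PNil
  end.

(* P{Q/X} *)
Fixpoint psubst (k : nat) (Q : proc) (P : proc) : proc :=
  match P with
  | PIn p l P => PIn p l (psubst k (vshift 0 Q) P)
  | POut p l e P => POut p l e (psubst k Q P)
  | PSum P1 P2 => PSum (psubst k Q P1) (psubst k Q P2)
  | PIf e P1 P2 => PIf e (psubst k Q P1) (psubst k Q P2)
  | PMu P => PMu (psubst (S k) (pshift 0 Q) P)
  | PVar X => if X =? k then Q else if k <? X then PVar (pred X) else PVar X
  | PNil => PNil
  end.

(* process variable [k] occurs in P only below input or output prefixes *)
Fixpoint prefixed (k : nat) (P : proc) : Prop :=
  match P with
  | PIn _ _ _ | POut _ _ _ _ | PNil => True
  | PSum P Q | PIf _ P Q => prefixed k P /\ prefixed k Q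
  | PMu P => prefixed (S k) P
  | PVar X => X <> k
  end.

Fixpoint guarded (P : proc) : Prop :=
  match P with
  | PIn _ _ P | POut _ _ _ P => guarded P
  | PSum P Q | PIf _ P Q => guarded P /\ guarded Q
  | PMu P => prefixed 0 P /\ guarded P
  | PVar _ | PNil => True
  end.

(* P is (any bracketing of) the iterated sum of the inputs q?l(x).Q for (l, Q)
   in bs; in particular bs is nonempty. *)
Inductive input_sum (q : participant) : proc -> list (label * proc) -> Prop :=
| input_sum_one l P : input_sum q (PIn q l P) [(l, P)]
| input_sum_plus P1 P2 bs1 bs2 :
    input_sum q P1 bs1 -> input_sum q P2 bs2 -> input_sum q (PSum P1 P2) (bs1 ++ bs2).

(* the least congruence on processes containing R *)
Inductive congruence_closure (R : proc -> proc -> Prop) : proc -> proc -> Prop :=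
| cc_base P Q : R P Q -> congruence_closure R P Q
| cc_refl P : congruence_closure R P P
| cc_sym P Q : congruence_closure R P Q -> congruence_closure R Q P
| cc_trans P Q P' :
    congruence_closure R P Q -> congruence_closure R Q P' -> congruence_closure R P P'
| cc_in p l P Q : congruence_closure R P Q -> congruence_closure R (PIn p l P) (PIn p l Q)
| cc_out p l e P Q :
    congruence_closure R P Q -> congruence_closure R (POut p l e P) (POut p l e Q)
| cc_sum P Q P' Q' :
    congruence_closure R P Q -> congruence_closure R P' Q' ->
    congruence_closure R (PSum P P') (PSum Q Q')
| cc_if e P Q P' Q' :
    congruence_closure R P Q -> congruence_closure R P' Q' ->
    congruence_closure R (PIf e P P') (PIf e Q Q')
| cc_mu P Q : congruence_closure R P Q -> congruence_closure R (PMu P) (PMu Q).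

Inductive unfold_axiom : proc -> proc -> Prop :=
| unfold_mu P : unfold_axiom (PMu P) (psubst 0 (PMu P) P).

(* the identification of mu X.P with its unfolding *)
Definition unfold_eq : proc -> proc -> Prop := congruence_closure unfold_axiom.

Inductive pcong_axiom : proc -> proc -> Prop :=
| pcong_unfold P : pcong_axiom (PMu P) (psubst 0 (PMu P) P)
| pcong_comm P Q : pcong_axiom (PSum P Q) (PSum Q P)
| pcong_assoc P Q P' : pcong_axiom (PSum (PSum P Q) P') (PSum P (PSum Q P')).

Definition pcong : proc -> proc -> Prop := congruence_closure pcong_axiom.

(* -------------------------------- Sessions -------------------------------- *)

Inductive session :=
| Role (p : participant) (P : proc)
| Par (M N : session).

Fixpoint components (M : session) : list (participant * proc) :=
  match M with
  | Role p P => [(p, P)]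
  | Par M N => components M ++ components N
  end.

Definition guarded_session (M : session) : Prop :=
  forall p P, In (p, P) (components M) -> guarded P.

Inductive scong : session -> session -> Prop :=
| sc_refl M : scong M M
| sc_sym M N : scong M N -> scong N M
| sc_trans M N M' : scong M N -> scong N M' -> scong M M'
| sc_par M M' N N' : scong M M' -> scong N N' -> scong (Par M N) (Par M' N')
| sc_proc p P Q : pcong P Q -> scong (Role p P) (Role p Q)
| sc_nil p M : scong (Par (Role p PNil) M) M
| sc_comm M N : scong (Par M N) (Par N M)
| sc_assoc M N M' : scong (Par (Par M N) M') (Par M (Par N M')).

Inductive red : session -> session -> Prop :=
| red_comm p q l e v P bs Pj Q :
    input_sum q P bs -> In (l, Pj) bs -> eval e v ->
    red (Par (Role p P) (Role q (POut p l e Q)))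
        (Par (Role p (vsubst 0 v Pj)) (Role q Q))
| red_true p e P Q : eval e (VBool true) -> red (Role p (PIf e P Q)) (Role p P)
| red_false p e P Q : eval e (VBool false) -> red (Role p (PIf e P Q)) (Role p Q)
| red_par M M' N : red M M' -> red (Par M N) (Par M' N)
| red_struct M M1 M1' M' : scong M M1 -> red M1 M1' -> scong M1' M' -> red M M'.

Definition reds : session -> session -> Prop := clos_refl_trans session red.

Definition stuck (M : session) : Prop :=
  (forall p, ~ scong M (Role p PNil)) /\ ~ (exists M', red M M').

(* ------------------------------ Session types ----------------------------- *)

Inductive sort := SNat | SInt | SBool.

Inductive subsort : sort -> sort -> Prop :=
| subsort_refl S : subsort S S
| subsort_nat_int : subsort SNat SInt.

Inductive stype :=
| TIn (p : participant) (bs : list (label * sort * stype))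
| TOut (p : participant) (bs : list (label * sort * stype))
| TMu (T : stype)
| TVar (t : nat)
| TEnd.

Definition labels {A : Type} (bs : list (label * sort * A)) : list label :=
  map (fun b => fst (fst b)) bs.

Definition disjoint_labels {A B : Type}
    (bs : list (label * sort * A)) (bs' : list (label * sort * B)) : Prop :=
  forall l, In l (labels bs) -> In l (labels bs') -> False.

Fixpoint tshift (k : nat) (T : stype) : stype :=
  match T with
  | TIn p bs => TIn p (map (fun '(l, s, U) => (l, s, tshift k U)) bs)
  | TOut p bs => TOut p (map (fun '(l, s, U) => (l, s, tshift k U)) bs)
  | TMu T => TMu (tshift (S k) T)
  | TVar t => if t <? k then TVar t else TVar (S t)
  | TEnd => TEnd
  end.

Fixpoint tsubst (k : nat) (V : stype) (T : stype) : stype :=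
  match T with
  | TIn p bs => TIn p (map (fun '(l, s, U) => (l, s, tsubst k V U)) bs)
  | TOut p bs => TOut p (map (fun '(l, s, U) => (l, s, tsubst k V U)) bs)
  | TMu T => TMu (tsubst (S k) (tshift 0 V) T)
  | TVar t => if t =? k then V else if k <? t then TVar (pred t) else TVar t
  | TEnd => TEnd
  end.

(* type variable [k] is not at the head of T *)
Fixpoint tprefixed (k : nat) (T : stype) : Prop :=
  match T with
  | TMu T => tprefixed (S k) T
  | TVar t => t <> k
  | _ => True
  end.

(* well-formed session types with free variables below [n] *)
Inductive twf : nat -> stype -> Prop :=
| twf_in n p bs :
    bs <> [] -> NoDup (labels bs) -> (forall l S T, In (l, S, T) bs -> twf n T) ->
    twf n (TIn p bs)
| twf_out n p bs :
    bs <> [] -> NoDup (labels bs) -> (forall l S T, In (l, S, T) bs -> twf n T) ->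
    twf n (TOut p bs)
| twf_mu n T : tprefixed 0 T -> twf (S n) T -> twf n (TMu T)
| twf_var n t : t < n -> twf n (TVar t)
| twf_end n : twf n TEnd.

(* U is the head normal form of T: its root is not a recursion *)
Inductive unfolds : stype -> stype -> Prop :=
| unfolds_head T : (forall U, T <> TMu U) -> unfolds T T
| unfolds_mu T U : unfolds (tsubst 0 (TMu T) T) U -> unfolds (TMu T) U.

(* Regular-tree equality, as the greatest bisimulation; branches are unordered. *)
Definition teq_branches (R : stype -> stype -> Prop)
    (bs bs' : list (label * sort * stype)) : Prop :=
  (forall l S U, In (l, S, U) bs -> exists U', In (l, S, U') bs' /\ R U U') /\
  (forall l S U', In (l, S, U') bs' -> exists U, In (l, S, U) bs /\ R U U').

Inductive teq_step (R : stype -> stype -> Prop) (T T' : stype) : Prop :=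
| teq_step_end : unfolds T TEnd -> unfolds T' TEnd -> teq_step R T T'
| teq_step_var t : unfolds T (TVar t) -> unfolds T' (TVar t) -> teq_step R T T'
| teq_step_in p bs bs' :
    unfolds T (TIn p bs) -> unfolds T' (TIn p bs') -> teq_branches R bs bs' ->
    teq_step R T T'
| teq_step_out p bs bs' :
    unfolds T (TOut p bs) -> unfolds T' (TOut p bs') -> teq_branches R bs bs' ->
    teq_step R T T'.

Definition teq (T T' : stype) : Prop :=
  exists R : stype -> stype -> Prop,
    (forall U U', R U U' -> teq_step R U U') /\ R T T'.

Inductive subtype_step (R : stype -> stype -> Prop) (T T' : stype) : Prop :=
| subtype_step_end : unfolds T TEnd -> unfolds T' TEnd -> subtype_step R T T'
| subtype_step_in p bs bs' :
    unfolds T (TIn p bs) -> unfolds T' (TIn p bs') ->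
    (forall l S' U', In (l, S', U') bs' ->
       exists S U, In (l, S, U) bs /\ subsort S' S /\ R U U') ->
    subtype_step R T T'
| subtype_step_out p bs bs' :
    unfolds T (TOut p bs) -> unfolds T' (TOut p bs') ->
    (forall l S U, In (l, S, U) bs ->
       exists S' U', In (l, S', U') bs' /\ subsort S S' /\ R U U') ->
    subtype_step R T T'.

Definition subtype (T T' : stype) : Prop :=
  exists R : stype -> stype -> Prop,
    (forall U U', R U U' -> subtype_step R U U') /\ R T T'.

Inductive merge (T T' : stype) : stype -> Prop :=
| merge_eq : teq T T' -> merge T T' T
| merge_in p bs bs' :
    unfolds T (TIn p bs) -> unfolds T' (TIn p bs') -> disjoint_labels bs bs' ->
    merge T T' (TIn p (bs ++ bs')).

(* The iterated merge over a nonempty unordered family.  The binary merge is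
   partial and not associative (T merges with T and with a disjoint T', but T
   does not merge with T /\ T'), so an iterated merge is taken to be defined as
   soon as some order and bracketing makes it defined; all of those that do
   yield the same tree. *)
Inductive merge_all : list stype -> stype -> Prop :=
| merge_all_one T : merge_all [T] T
| merge_all_node Ts Ts1 Ts2 T1 T2 T :
    Permutation Ts (Ts1 ++ Ts2) ->
    merge_all Ts1 T1 -> merge_all Ts2 T2 -> merge T1 T2 T -> merge_all Ts T.

(* T1 \/ T2, when it is a session type: the union of two sets of outputs to the
   same participant, or T1 itself when both sides are equal. *)
Inductive union_type (T1 T2 : stype) : stype -> Prop :=
| union_eq : teq T1 T2 -> union_type T1 T2 T1
| union_out q bs1 bs2 :
    unfolds T1 (TOut q bs1) -> unfolds T2 (TOut q bs2) -> disjoint_labels bs1 bs2 ->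
    union_type T1 T2 (TOut q (bs1 ++ bs2)).

(* ------------------------------ Global types ------------------------------ *)

Inductive gtype :=
| GMsg (p q : participant) (bs : list (label * sort * gtype))
| GMu (G : gtype)
| GVar (t : nat)
| GEnd.

Fixpoint pt (G : gtype) : list participant :=
  match G with
  | GMsg p q bs => p :: q :: flat_map (fun '(_, _, G) => pt G) bs
  | GMu G => pt G
  | GVar _ | GEnd => []
  end.

Fixpoint gprefixed (k : nat) (G : gtype) : Prop :=
  match G with
  | GMsg _ _ _ | GEnd => True
  | GMu G => gprefixed (S k) G
  | GVar t => t <> k
  end.

(* well-formed global types with free variables below [n] *)
Inductive gwf : nat -> gtype -> Prop :=
| gwf_msg n p q bs :
    p <> q -> bs <> [] -> NoDup (labels bs) ->
    (forall l S G, In (l, S, G) bs -> gwf n G) ->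
    gwf n (GMsg p q bs)
| gwf_mu n G : gprefixed 0 G -> gwf (S n) G -> gwf n (GMu G)
| gwf_var n t : t < n -> gwf n (GVar t)
| gwf_end n : gwf n GEnd.

Inductive gfree : nat -> gtype -> Prop :=
| gfree_msg k p q bs l S G : In (l, S, G) bs -> gfree k G -> gfree k (GMsg p q bs)
| gfree_mu k G : gfree (S k) G -> gfree k (GMu G)
| gfree_var k : gfree k (GVar k).

(* [r] occurs in the body G of mu t.G, read up to regular-tree equality: a
   variable of G other than t stands for an enclosing recursion, and projection
   enters a recursion only if r occurs in it, so r occurs in the tree of G as
   soon as G has such a variable.  (Testing r \in pt(G) alone would project
     mu t. p->r:l. mu t'. p->q:{l1.t', l2.t}
   on r to mu t. p?l.end, although r must receive again after each l2.) *)
Definition occurs (r : participant) (G : gtype) : Prop :=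
  In r (pt G) \/ exists k, gfree (S k) G.

Inductive proj (r : participant) : gtype -> stype -> Prop :=
| proj_sender q bs bs' :
    Forall2 (fun b b' => fst b = fst b' /\ proj r (snd b) (snd b')) bs bs' ->
    proj r (GMsg r q bs) (TOut q bs')
| proj_receiver p bs bs' :
    p <> r ->
    Forall2 (fun b b' => fst b = fst b' /\ proj r (snd b) (snd b')) bs bs' ->
    proj r (GMsg p r bs) (TIn p bs')
| proj_other p q bs Ts T :
    p <> r -> q <> r ->
    Forall2 (fun b U => proj r (snd b) U) bs Ts ->
    merge_all Ts T ->
    proj r (GMsg p q bs) T
| proj_mu G T : occurs r G -> proj r G T -> proj r (GMu G) (TMu T)
| proj_mu_end G : ~ occurs r G -> proj r (GMu G) TEnd
| proj_var t : proj r (GVar t) (TVar t)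
| proj_end : proj r GEnd TEnd.

(* --------------------------------- Typing --------------------------------- *)

Inductive etyped (Gamma : list sort) : expr -> sort -> Prop :=
| et_nat n : (0 <= n)%Z -> etyped Gamma (EVal (VNum n)) SNat
| et_int i : etyped Gamma (EVal (VNum i)) SInt
| et_bool b : etyped Gamma (EVal (VBool b)) SBool
| et_var x S : nth_error Gamma x = Some S -> etyped Gamma (EVar x) S
| et_succ e : etyped Gamma e SNat -> etyped Gamma (ESucc e) SNat
| et_neg e : etyped Gamma e SInt -> etyped Gamma (ENeg e) SInt
| et_not e : etyped Gamma e SBool -> etyped Gamma (ENot e) SBool
| et_choice e1 e2 S :
    etyped Gamma e1 S -> etyped Gamma e2 S -> etyped Gamma (EChoice e1 e2) S
| et_gt e1 e2 :
    etyped Gamma e1 SInt -> etyped Gamma e2 SInt -> etyped Gamma (EGt e1 e2) SBool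
| et_sub e S S' : etyped Gamma e S -> subsort S S' -> etyped Gamma e S'.

(* [Gamma] types expression variables and [Delta] process variables.  All types
   in a derivation are well formed and closed.  [ptyped_unfold] expresses that
   processes are taken up to unfolding of recursion. *)
Inductive ptyped : list sort -> list stype -> proc -> stype -> Prop :=
| ptyped_in Gamma Delta q P (bs : list (label * sort * proc * stype)) :
    input_sum q P (map (fun '(l, _, Q, _) => (l, Q)) bs) ->
    NoDup (map (fun '(l, _, _, _) => l) bs) ->
    (forall l S Q T, In (l, S, Q, T) bs -> ptyped (S :: Gamma) Delta Q T) ->
    ptyped Gamma Delta P (TIn q (map (fun '(l, s, _, T) => (l, s, T)) bs))
| ptyped_nil Gamma Delta : ptyped Gamma Delta PNil TEnd
| ptyped_out Gamma Delta q l e P S T :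
    etyped Gamma e S -> ptyped Gamma Delta P T ->
    ptyped Gamma Delta (POut q l e P) (TOut q [(l, S, T)])
| ptyped_if Gamma Delta e P1 P2 T1 T2 T :
    etyped Gamma e SBool -> ptyped Gamma Delta P1 T1 -> ptyped Gamma Delta P2 T2 ->
    union_type T1 T2 T ->
    ptyped Gamma Delta (PIf e P1 P2) T
| ptyped_mu Gamma Delta P T :
    twf 0 T -> ptyped Gamma (T :: Delta) P T -> ptyped Gamma Delta (PMu P) T
| ptyped_var Gamma Delta X T :
    nth_error Delta X = Some T -> ptyped Gamma Delta (PVar X) T
| ptyped_sub Gamma Delta P T T' :
    ptyped Gamma Delta P T -> twf 0 T' -> subtype T T' -> ptyped Gamma Delta P T'
| ptyped_unfold Gamma Delta P Q T :
    ptyped Gamma Delta P T -> unfold_eq P Q -> ptyped Gamma Delta Q T.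

(* The p_i of a typed session are pairwise distinct: p <| P | p <| P with
   P = q!l(e).0, next to q <| p?l(x).0, gets stuck. *)
Inductive styped (M : session) (G : gtype) : Prop :=
| st_session :
    gwf 0 G ->
    NoDup (map fst (components M)) ->
    (forall p P, In (p, P) (components M) ->
       exists T, proj p G T /\ ptyped [] [] P T) ->
    incl (pt G) (map fst (components M)) ->
    styped M G.

(* Main.v *)
(** Fix an environment giving each participant its current session type.  It is [coherent] if
    it behaves like the projections of a global tree: at the root some [p] sends to some [q],
    every branch is again coherent, and every participant that has not ended acts within a
    bounded number [d r] of messages.  Projection yields coherent environments: the output
    parts of merged types coincide, so a participant with a pending action acts on every path
    of the global type, and the merge of its branches is a subtype of each of them.  The bound
    [d] then lets any matching output/input pair communicate, by induction on its depth below
    the root, so coherence is preserved by reduction; and the pair at the root of a coherent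
    environment always gives a redex.

    Processes are typed up to structural congruence and subtyping.  The inversion of typing
    goes through the multiset of top-level summands of a process, which exists because
    recursion is guarded and is invariant under congruence. *)

(* Reduction may fire a pair that is not at the root of the global type. A syntactic residual would
   then have to be found, with the communication removed below other messages and across recursions,
   and its projections merged again. Coherence is stated on environments alone, so the residual is a
   possibly infinite tree given by coinduction and is never written as a [gtype]. Coinduction alone
   would let a ready pair be postponed forever along some path, and its removal below the root would
   not terminate; the bound [d] excludes this. Each message lowers the bound of everyone who does
   not take part in it and resets it for the two who do. Removing a communication must not raise the
   bound of third parties, since the rebuilt root still has to lower it. Congruence lets inert
   components of any name appear and vanish. The participants of a session are therefore tracked as
   a list that may lose members whose type has ended. *)
From Stdlib Require Import Lia SetoidList SetoidPermutation RelationClasses.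
From Stdlib Require Import FunctionalExtensionality.
Require Import Defs.

#[local] Arguments Nat.eqb : simpl never.
#[local] Arguments Nat.ltb : simpl never.

(** * Expressions and processes *)

Ltac index_cases :=
  repeat (simpl in *;
    match goal with
    | |- context [?a =? ?b] => destruct (Nat.eqb_spec a b)
    | |- context [?a <? ?b] => destruct (Nat.ltb_spec a b)
    end); simpl in *; subst; try lia; auto.

Definition has_sort (v : value) (S : sort) : Prop := etyped [] (EVal v) S.

Lemma etyped_value Gamma Gamma' v S : etyped Gamma (EVal v) S -> etyped Gamma' (EVal v) S.
Proof.
  intros H. remember (EVal v) as e eqn:E. revert v E.
  induction H; intros w E; inversion E; subst; try (constructor; assumption).
  eapply et_sub; eauto.
Qed.

Lemma has_sort_sub v S S' : has_sort v S -> subsort S S' -> has_sort v S'.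
Proof. intros; eapply et_sub; eauto. Qed.

Lemma subsort_trans S1 S2 S3 : subsort S1 S2 -> subsort S2 S3 -> subsort S1 S3.
Proof. intros [] H; inversion H; subst; auto using subsort_nat_int, subsort_refl. Qed.

Lemma has_sort_inv v S :
  has_sort v S ->
  match S with
  | SNat => exists n, v = VNum n /\ (0 <= n)%Z
  | SInt => exists n, v = VNum n
  | SBool => exists b, v = VBool b
  end.
Proof.
  unfold has_sort; intros H. remember (EVal v) as e eqn:E. revert v E.
  induction H as [| | | | | | | | |e S S' H IH HS]; intros v E; inversion E; subst; eauto.
  specialize (IH _ eq_refl). destruct HS; auto.
  destruct IH as (n & ? & ?); eauto.
Qed.

(** [eval_ctx] evaluates the hole and then the refilled context, so preservation needs one sort [S']
    that types the hole and that any replacement may use. Subsumption steps around the context are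
    reapplied after the replacement. *)
Lemma etyped_fill Gamma E e S :
  etyped Gamma (fill E e) S ->
  exists S', etyped Gamma e S' /\
    forall e', etyped Gamma e' S' -> etyped Gamma (fill E e') S.
Proof.
  revert S. induction E; simpl; intros S H; [exists S; auto| ..];
  match type of H with etyped _ ?t _ => remember t as f eqn:Ef end;
  induction H; inversion Ef; subst;
  repeat match goal with
  | IHE : forall S, etyped _ (fill ?E _) S -> _, H : etyped _ (fill ?E _) _ |- _ =>
      destruct (IHE _ H) as (S0 & ? & ?); clear IHE
  | IH : ?x = ?x -> _ |- _ => destruct (IH eq_refl) as (S0 & ? & ?); clear IH
  end; exists S0; split; auto; intros; try (constructor; auto; fail); eapply et_sub; eauto.
Qed.

Lemma etyped_inv_choice Gamma e1 e2 S :
  etyped Gamma (EChoice e1 e2) S -> etyped Gamma e1 S /\ etyped Gamma e2 S.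
Proof.
  intros H. remember (EChoice e1 e2) as e eqn:E.
  induction H as [| | | | | | | | |e S S' H IH HS]; inversion E; subst; auto.
  destruct IH; split; eauto using et_sub.
Qed.

Lemma eval_preserves e v : eval e v -> forall S, etyped [] e S -> has_sort v S.
Proof.
  induction 1 as [n Hn|i|b|v|i1 i2|e1 e2 v _ IH|e1 e2 v _ IH|E e v v' _ IH1 _ IH2]; intros S HT.
  - remember (ESucc (EVal (VNum n))) as e eqn:E.
    induction HT; inversion E; subst; [constructor; lia | eapply has_sort_sub; eauto].
  - remember (ENeg (EVal (VNum i))) as e eqn:E.
    induction HT; inversion E; subst; [constructor | eapply has_sort_sub; eauto].
  - remember (ENot (EVal (VBool b))) as e eqn:E.
    induction HT; inversion E; subst; [constructor | eapply has_sort_sub; eauto].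
  - exact HT.
  - remember (EGt (EVal (VNum i1)) (EVal (VNum i2))) as e eqn:E.
    induction HT; inversion E; subst; [constructor | eapply has_sort_sub; eauto].
  - apply IH, (etyped_inv_choice _ _ _ _ HT).
  - apply IH, (etyped_inv_choice _ _ _ _ HT).
  - destruct (etyped_fill _ _ _ _ HT) as (S' & He & Hf). apply IH2, Hf, IH1, He.
Qed.

(** [eval_preserves] gives the canonical form of each evaluated operand, so the primitive rule
    applies; for [ESucc] the sort [SNat] supplies the nonnegativity that [eval_succ] asks for. *)
Lemma eval_total e S : etyped [] e S -> exists v, eval e v /\ has_sort v S.
Proof.
  intros H. enough (exists v, eval e v) as [v Hv] by eauto using eval_preserves.
  remember [] as Gamma eqn:EG.
  induction H as [n|i|b|x S H|e H IH|e H IH|e H IH|e1 e2 S H1 IH1 H2 IH2|e1 e2 H1 IH1 H2 IH2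
                 |e S S' H IH]; subst; try (eexists; apply eval_val).
  - destruct x; discriminate.
  - destruct IH as [v Hv]; auto.
    destruct (has_sort_inv _ _ (eval_preserves _ _ Hv _ H)) as (n & -> & Hn).
    eexists. eapply (eval_ctx (CSucc CHole)); [eassumption|]. apply eval_succ; auto.
  - destruct IH as [v Hv]; auto.
    destruct (has_sort_inv _ _ (eval_preserves _ _ Hv _ H)) as (n & ->).
    eexists. eapply (eval_ctx (CNeg CHole)); [eassumption|]. apply eval_neg.
  - destruct IH as [v Hv]; auto.
    destruct (has_sort_inv _ _ (eval_preserves _ _ Hv _ H)) as (b & ->).
    eexists. eapply (eval_ctx (CNot CHole)); [eassumption|]. apply eval_not.
  - destruct IH1 as [v Hv]; auto. eexists; apply eval_choice_l; eauto.
  - destruct IH1 as [v Hv], IH2 as [w Hw]; auto.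
    destruct (has_sort_inv _ _ (eval_preserves _ _ Hv _ H1)) as (n & ->).
    destruct (has_sort_inv _ _ (eval_preserves _ _ Hw _ H2)) as (m & ->).
    eexists. eapply (eval_ctx (CGtL CHole e2)); [eassumption|].
    eapply (eval_ctx (CGtR _ CHole)); [eassumption|]. apply eval_gt.
  - auto.
Qed.

(** * Shifting and substitution of de Bruijn indices *)

Lemma etyped_eshift Gamma1 Gamma2 S0 e S :
  etyped (Gamma1 ++ Gamma2) e S ->
  etyped (Gamma1 ++ S0 :: Gamma2) (eshift (length Gamma1) e) S.
Proof.
  intros H. remember (Gamma1 ++ Gamma2) as Gamma eqn:EG.
  induction H; subst; simpl; try (econstructor; eauto; fail).
  index_cases; constructor.
  - rewrite nth_error_app1 in * by lia; auto.
  - rewrite nth_error_app2 in * by lia.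
    replace (Datatypes.S x - length Gamma1) with (Datatypes.S (x - length Gamma1)) by lia; auto.
Qed.

Lemma etyped_esubst Gamma1 Gamma2 S0 v e S :
  etyped (Gamma1 ++ S0 :: Gamma2) e S -> has_sort v S0 ->
  etyped (Gamma1 ++ Gamma2) (esubst (length Gamma1) v e) S.
Proof.
  intros H Hv. remember (Gamma1 ++ S0 :: Gamma2) as Gamma eqn:EG.
  induction H; subst; simpl; try (econstructor; eauto; fail).
  index_cases.
  - rewrite nth_error_app2, Nat.sub_diag in H by lia. injection H as <-.
    eapply etyped_value; eauto.
  - constructor. rewrite nth_error_app2 in * by lia.
    destruct x; [lia|]. simpl.
    replace (Datatypes.S x - length Gamma1) with (Datatypes.S (x - length Gamma1)) in H by lia.
    auto.
  - constructor. rewrite nth_error_app1 in * by lia; auto.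
Qed.

Lemma eshift_eshift i j e : i <= j -> eshift (S j) (eshift i e) = eshift i (eshift j e).
Proof. intros; induction e; simpl; try (index_cases; fail); f_equal; auto. Qed.

Lemma esubst_eshift i j v e :
  i <= j -> esubst (S j) v (eshift i e) = eshift i (esubst j v e).
Proof. intros; induction e; simpl; try (index_cases; f_equal; lia); f_equal; auto. Qed.

Lemma vshift_vshift P : forall i j, i <= j -> vshift (S j) (vshift i P) = vshift i (vshift j P).
Proof.
  induction P; simpl; intros; f_equal; auto using eshift_eshift.
  apply IHP; lia.
Qed.

Lemma vsubst_vshift v P : forall i j,
  i <= j -> vsubst (S j) v (vshift i P) = vshift i (vsubst j v P).
Proof.
  induction P; simpl; intros; f_equal; auto using esubst_eshift.
  apply IHP; lia.
Qed.

Lemma vshift_pshift P : forall i j, vshift i (pshift j P) = pshift j (vshift i P).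
Proof. induction P; simpl; intros; try (index_cases; fail); f_equal; auto. Qed.

Lemma vsubst_pshift v P : forall i j, vsubst i v (pshift j P) = pshift j (vsubst i v P).
Proof. induction P; simpl; intros; try (index_cases; fail); f_equal; auto. Qed.

Lemma pshift_pshift P : forall i j, i <= j -> pshift (S j) (pshift i P) = pshift i (pshift j P).
Proof.
  induction P; simpl; intros; try (index_cases; fail); f_equal; auto.
  apply IHP; lia.
Qed.

Lemma vshift_psubst P : forall i j A,
  vshift i (psubst j A P) = psubst j (vshift i A) (vshift i P).
Proof.
  induction P; simpl; intros; try (index_cases; fail); f_equal; auto.
  - rewrite IHP, vshift_vshift by lia; auto.
  - rewrite IHP, vshift_pshift; auto.
Qed.

Lemma vsubst_psubst v P : forall i j A,
  vsubst i v (psubst j A P) = psubst j (vsubst i v A) (vsubst i v P).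
Proof.
  induction P; simpl; intros; try (index_cases; fail); f_equal; auto.
  - rewrite IHP, vsubst_vshift by lia; auto.
  - rewrite IHP, vsubst_pshift; auto.
Qed.

Lemma pshift_psubst P : forall i j A,
  j <= i -> pshift i (psubst j A P) = psubst j (pshift i A) (pshift (S i) P).
Proof.
  induction P; simpl; intros; try (index_cases; f_equal; lia); f_equal; auto.
  - rewrite IHP, vshift_pshift by lia; auto.
  - rewrite IHP, pshift_pshift by lia; auto.
Qed.

Lemma psubst_pshift P : forall i j A,
  j <= i -> psubst (S i) (pshift j A) (pshift j P) = pshift j (psubst i A P).
Proof.
  induction P; simpl; intros; try (index_cases; f_equal; lia); f_equal; auto.
  - rewrite vshift_pshift, IHP by lia; auto.
  - rewrite <- pshift_pshift, IHP by lia; auto.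
Qed.

Lemma psubst_pshift_cancel P : forall j A, psubst j A (pshift j P) = P.
Proof. induction P; simpl; intros; try (index_cases; fail); f_equal; auto. Qed.

(** With [A] a recursion and [j = 0] this commutes unfolding with substitution, which makes the
    unfolding axiom stable under [psubst]. *)
Lemma psubst_psubst P : forall i j A B,
  j <= i ->
  psubst i B (psubst j A P) = psubst j (psubst i B A) (psubst (S i) (pshift j B) P).
Proof.
  induction P; simpl; intros;
    try (index_cases; rewrite ?psubst_pshift_cancel; auto; f_equal; lia); f_equal; auto.
  - rewrite IHP by lia. rewrite vshift_psubst, vshift_pshift; auto.
  - rewrite IHP by lia. rewrite psubst_pshift, pshift_pshift by lia; auto.
Qed.

(** * Stability of congruence under shifts and substitutions *)

Lemma unfold_axiom_vshift k P Q :
  unfold_axiom P Q -> unfold_axiom (vshift k P) (vshift k Q).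
Proof. intros []. simpl. rewrite vshift_psubst. constructor. Qed.

Lemma unfold_axiom_vsubst k v P Q :
  unfold_axiom P Q -> unfold_axiom (vsubst k v P) (vsubst k v Q).
Proof. intros []. simpl. rewrite vsubst_psubst. constructor. Qed.

Lemma unfold_axiom_pshift k P Q :
  unfold_axiom P Q -> unfold_axiom (pshift k P) (pshift k Q).
Proof. intros []. simpl. rewrite pshift_psubst by lia. constructor. Qed.

Lemma unfold_axiom_psubst k A P Q :
  unfold_axiom P Q -> unfold_axiom (psubst k A P) (psubst k A Q).
Proof. intros []. simpl. rewrite psubst_psubst by lia. constructor. Qed.

Lemma pcong_axiom_unfold P Q : unfold_axiom P Q -> pcong_axiom P Q.
Proof. intros []; constructor. Qed.

Lemma pcong_axiom_cases P Q :
  pcong_axiom P Q ->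
  unfold_axiom P Q \/ (exists A B, P = PSum A B /\ Q = PSum B A) \/
  (exists A B C, P = PSum (PSum A B) C /\ Q = PSum A (PSum B C)).
Proof. intros []; [left; constructor | right; left | right; right]; eauto. Qed.

Ltac pcong_axiom_map L :=
  intros H; destruct (pcong_axiom_cases _ _ H)
    as [H'|[(A0 & B0 & -> & ->)|(A0 & B0 & C0 & -> & ->)]];
  simpl; try constructor; apply pcong_axiom_unfold, L, H'.

Lemma pcong_axiom_vshift k P Q : pcong_axiom P Q -> pcong_axiom (vshift k P) (vshift k Q).
Proof. pcong_axiom_map unfold_axiom_vshift. Qed.

Lemma pcong_axiom_vsubst k v P Q :
  pcong_axiom P Q -> pcong_axiom (vsubst k v P) (vsubst k v Q).
Proof. pcong_axiom_map unfold_axiom_vsubst. Qed.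

Lemma pcong_axiom_pshift k P Q : pcong_axiom P Q -> pcong_axiom (pshift k P) (pshift k Q).
Proof. pcong_axiom_map unfold_axiom_pshift. Qed.

Lemma pcong_axiom_psubst k A P Q :
  pcong_axiom P Q -> pcong_axiom (psubst k A P) (psubst k A Q).
Proof. pcong_axiom_map unfold_axiom_psubst. Qed.

Section CongruenceMaps.
Variable R : proc -> proc -> Prop.

(** [R] is left abstract here and below: [ptyped_unfold] needs unfolding alone, reduction needs the
    full congruence. *)
Lemma cc_vshift :
  (forall k P Q, R P Q -> R (vshift k P) (vshift k Q)) ->
  forall P Q, congruence_closure R P Q ->
  forall k, congruence_closure R (vshift k P) (vshift k Q).
Proof.
  intros HR P Q H; induction H; intros; simpl; eauto using congruence_closure.
Qed.

Lemma cc_vsubst v :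
  (forall k P Q, R P Q -> R (vsubst k v P) (vsubst k v Q)) ->
  forall P Q, congruence_closure R P Q ->
  forall k, congruence_closure R (vsubst k v P) (vsubst k v Q).
Proof.
  intros HR P Q H; induction H; intros; simpl; eauto using congruence_closure.
Qed.

Lemma cc_pshift :
  (forall k P Q, R P Q -> R (pshift k P) (pshift k Q)) ->
  forall P Q, congruence_closure R P Q ->
  forall k, congruence_closure R (pshift k P) (pshift k Q).
Proof.
  intros HR P Q H; induction H; intros; simpl; eauto using congruence_closure.
Qed.

Lemma cc_psubst :
  (forall k A P Q, R P Q -> R (psubst k A P) (psubst k A Q)) ->
  forall P Q, congruence_closure R P Q ->
  forall k A, congruence_closure R (psubst k A P) (psubst k A Q).
Proof.
  intros HR P Q H; induction H; intros; simpl; eauto using congruence_closure.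
Qed.
End CongruenceMaps.

Lemma unfold_eq_pcong P Q : unfold_eq P Q -> pcong P Q.
Proof.
  unfold pcong; induction 1; eauto using congruence_closure, pcong_axiom_unfold.
Qed.

Lemma pcong_vshift k P Q : pcong P Q -> pcong (vshift k P) (vshift k Q).
Proof. intros; apply cc_vshift; auto using pcong_axiom_vshift. Qed.

Lemma pcong_vsubst k v P Q : pcong P Q -> pcong (vsubst k v P) (vsubst k v Q).
Proof. intros; apply cc_vsubst; auto using pcong_axiom_vsubst. Qed.

Lemma pcong_pshift k P Q : pcong P Q -> pcong (pshift k P) (pshift k Q).
Proof. intros; apply cc_pshift; auto using pcong_axiom_pshift. Qed.

Lemma pcong_psubst_arg P : forall k A B, pcong A B -> pcong (psubst k A P) (psubst k B P).
Proof.
  unfold pcong.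
  induction P; simpl; intros; auto using cc_out, cc_sum, cc_if, cc_refl.
  - apply cc_in, IHP, pcong_vshift; auto.
  - apply cc_mu, IHP, pcong_pshift; auto.
  - index_cases; apply cc_refl.
Qed.

Lemma pcong_psubst k A B P Q : pcong A B -> pcong P Q -> pcong (psubst k A P) (psubst k B Q).
Proof.
  intros HA HP. eapply cc_trans.
  - apply cc_psubst; eauto using pcong_axiom_psubst.
  - apply pcong_psubst_arg; auto.
Qed.

(** * Guardedness under substitution and congruence *)

Lemma prefixed_vshift P : forall k i, prefixed k (vshift i P) <-> prefixed k P.
Proof. induction P; simpl; intros; rewrite ?IHP1, ?IHP2; auto; tauto. Qed.

Lemma guarded_vshift P : forall i, guarded (vshift i P) <-> guarded P.
Proof.
  induction P; simpl; intros; rewrite ?IHP1, ?IHP2, ?prefixed_vshift, ?IHP; tauto.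
Qed.

Lemma prefixed_vsubst v P : forall k i, prefixed k (vsubst i v P) <-> prefixed k P.
Proof. induction P; simpl; intros; rewrite ?IHP1, ?IHP2; auto; tauto. Qed.

Lemma guarded_vsubst v P : forall i, guarded (vsubst i v P) <-> guarded P.
Proof.
  induction P; simpl; intros; rewrite ?IHP1, ?IHP2, ?prefixed_vsubst, ?IHP; tauto.
Qed.

Lemma prefixed_pshift_eq P : forall k, prefixed k (pshift k P).
Proof. induction P; simpl; auto; intros; index_cases. Qed.

Lemma prefixed_pshift_lt P : forall k j, k < j -> (prefixed k (pshift j P) <-> prefixed k P).
Proof.
  induction P; simpl; intros; rewrite ?IHP1, ?IHP2 by auto; try tauto.
  - apply IHP; lia.
  - index_cases; lia.
Qed.

Lemma prefixed_pshift_ge P : forall k j, j <= k -> (prefixed (S k) (pshift j P) <-> prefixed k P).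
Proof.
  induction P; simpl; intros; rewrite ?IHP1, ?IHP2 by auto; try tauto.
  - apply IHP; lia.
  - index_cases; lia.
Qed.

Lemma guarded_pshift P : forall j, guarded (pshift j P) <-> guarded P.
Proof.
  induction P; simpl; intros; rewrite ?IHP1, ?IHP2, ?IHP; try tauto.
  - rewrite prefixed_pshift_lt by lia; tauto.
  - index_cases; tauto.
Qed.

Lemma prefixed_psubst_ge P : forall k j A,
  j <= k ->
  (prefixed k (psubst j A P) <-> prefixed (S k) P /\ (prefixed j P \/ prefixed k A)).
Proof.
  induction P; simpl; intros; rewrite ?IHP1, ?IHP2 by auto; try tauto.
  - rewrite IHP, prefixed_pshift_ge by lia; tauto.
  - index_cases; lia || (split; intros; [split; [lia|right; auto]|tauto]).
Qed.

Lemma prefixed_psubst_lt P : forall k j A,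
  k < j ->
  (prefixed k (psubst j A P) <-> prefixed k P /\ (prefixed j P \/ prefixed k A)).
Proof.
  induction P; simpl; intros; rewrite ?IHP1, ?IHP2 by auto; try tauto.
  - rewrite IHP, prefixed_pshift_ge by lia; tauto.
  - index_cases; lia || (split; intros; [split; [lia|right; auto]|tauto]).
Qed.

(** [prefixed] looks only above prefixes, but a process substituted below a prefix also has to be
    guarded for the result to be, so [guarded_psubst] must know whether the variable occurs
    anywhere. *)
Fixpoint nofree (k : nat) (P : proc) : Prop :=
  match P with
  | PIn _ _ P | POut _ _ _ P => nofree k P
  | PSum P Q | PIf _ P Q => nofree k P /\ nofree k Q
  | PMu P => nofree (S k) P
  | PVar X => X <> k
  | PNil => True
  end.

Lemma nofree_prefixed P : forall k, nofree k P -> prefixed k P.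
Proof. induction P; simpl; intuition. Qed.

Lemma guarded_psubst P : forall j A,
  guarded (psubst j A P) <-> guarded P /\ (nofree j P \/ guarded A).
Proof.
  induction P; simpl; intros; rewrite ?IHP1, ?IHP2, ?IHP, ?guarded_vshift by auto; try tauto.
  - rewrite prefixed_psubst_lt, guarded_pshift by lia.
    pose proof (prefixed_pshift_eq A 0). tauto.
  - index_cases; lia || tauto.
Qed.

(** A copy of the recursion that unfolding puts at a head position brings no free head variable
    beyond those of the body. *)
Lemma prefixed_pcong P Q : pcong P Q -> forall k, prefixed k P <-> prefixed k Q.
Proof.
  induction 1 as [P Q []| | | | | | | |]; intros k; simpl;
  rewrite ?prefixed_psubst_ge by lia; simpl; try tauto;
  repeat match goal with IH : forall k, prefixed k _ <-> _ |- _ =>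
    pose proof (IH k); pose proof (IH (S k)); clear IH end; tauto.
Qed.

(** From the unfolding back to the recursion, either the bound variable occurs and a copy of [PMu P]
    inside the unfolding must itself be guarded, or it occurs nowhere and is trivially
    [prefixed]. *)
Lemma guarded_pcong P Q : pcong P Q -> guarded P <-> guarded Q.
Proof.
  induction 1 as [P Q [P0|?|?]| | | | | | | |]; simpl; try tauto.
  - rewrite guarded_psubst; simpl. pose proof (nofree_prefixed P0 0). tauto.
  - rewrite (prefixed_pcong _ _ H 0). tauto.
Qed.

(** * Summands of a process *)

(** A relation, since unfolding is not structural and need not end. [PNil] is a summand like any
    other because congruence has no unit law for [PSum]. *)
Inductive summands : proc -> list proc -> Prop :=
| summands_in p l P : summands (PIn p l P) [PIn p l P]
| summands_out p l e P : summands (POut p l e P) [POut p l e P]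
| summands_if e P Q : summands (PIf e P Q) [PIf e P Q]
| summands_var X : summands (PVar X) [PVar X]
| summands_nil : summands PNil [PNil]
| summands_sum P Q L L' :
    summands P L -> summands Q L' -> summands (PSum P Q) (L ++ L')
| summands_mu P L : summands (psubst 0 (PMu P) P) L -> summands (PMu P) L.

Lemma summands_det P L : summands P L -> forall L', summands P L' -> L = L'.
Proof.
  induction 1; intros L'' H''; inversion H''; subst; auto. f_equal; auto.
Qed.

Lemma summands_nonempty P L : summands P L -> L <> [].
Proof.
  induction 1; try discriminate; auto.
  intros E; apply app_eq_nil in E; tauto.
Qed.

Lemma summands_single P a : summands P [a] -> pcong P a.
Proof.
  intros H. remember [a] as L eqn:E. revert a E.
  induction H; intros a E; try (inversion E; subst; apply cc_refl).
  - apply summands_nonempty in H, H0.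
    destruct L as [|? [|]], L'; simpl in *; inversion E; subst; congruence.
  - eapply cc_trans; [apply cc_base; constructor | exact (IHsummands _ E)].
Qed.

Lemma summands_guarded P L : summands P L -> guarded P -> Forall guarded L.
Proof.
  induction 1; intros HG; try (constructor; auto; fail).
  - destruct HG. apply Forall_app; auto.
  - apply IHsummands. rewrite guarded_psubst. destruct HG; simpl; auto.
Qed.

Lemma summands_prefixed P L : summands P L -> forall k, prefixed k P -> ~ In (PVar k) L.
Proof.
  induction 1; intros k Hk; simpl; try (intros [E|[]]; inversion E; subst; auto; fail).
  - destruct Hk. rewrite in_app_iff. firstorder.
  - apply IHsummands. apply prefixed_psubst_ge; [lia|]. simpl; auto.
Qed.

(** Were [PVar k] a summand, it would turn into the summands of [A], and the new list would not be
    the image of the old one. *)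
Lemma summands_psubst P L : summands P L -> forall k A,
  ~ In (PVar k) L -> summands (psubst k A P) (map (psubst k A) L).
Proof.
  induction 1; intros k A Hk; simpl; try (constructor; fail).
  - simpl in Hk. destruct (Nat.eqb_spec X k); [subst; tauto|].
    destruct (k <? X); constructor.
  - rewrite in_app_iff in Hk. rewrite map_app. constructor; auto.
  - constructor. specialize (IHsummands k A Hk). rewrite psubst_psubst in IHsummands by lia.
    exact IHsummands.
Qed.

(** Guardedness lets the recursion be substituted into the finished list of the body, so summands
    are found by structural recursion and not by repeated unfolding. *)
Lemma summands_mu_intro P L :
  prefixed 0 P -> summands P L -> summands (PMu P) (map (psubst 0 (PMu P)) L).
Proof.
  intros Hp HL. constructor. apply summands_psubst; auto. eapply summands_prefixed; eauto.
Qed.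

Lemma summands_exist P : guarded P -> exists L, summands P L.
Proof.
  induction P; simpl; intros HG; try (eexists; constructor; fail).
  - destruct HG, IHP1, IHP2; auto. eexists; constructor; eauto.
  - destruct HG, IHP as [L HL]; auto. eexists; apply summands_mu_intro; eauto.
Qed.

(* The last two rules only make [atom_eq] reflexive: no summand is a sum or a recursion. *)
Inductive atom_eq : proc -> proc -> Prop :=
| atom_in p l P Q : pcong P Q -> atom_eq (PIn p l P) (PIn p l Q)
| atom_out p l e P Q : pcong P Q -> atom_eq (POut p l e P) (POut p l e Q)
| atom_if e P Q P' Q' : pcong P Q -> pcong P' Q' -> atom_eq (PIf e P P') (PIf e Q Q')
| atom_var X : atom_eq (PVar X) (PVar X)
| atom_nil : atom_eq PNil PNil
| atom_sum P Q P' Q' : pcong P P' -> pcong Q Q' -> atom_eq (PSum P Q) (PSum P' Q')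
| atom_mu P Q : pcong P Q -> atom_eq (PMu P) (PMu Q).

#[local] Instance atom_eq_equiv : Equivalence atom_eq.
Proof.
  split.
  - intros []; constructor; apply cc_refl.
  - intros P Q []; constructor; apply cc_sym; auto.
  - intros P Q Q' H H'; inversion H; subst; inversion H'; subst; auto;
    constructor; eapply cc_trans; eauto.
Qed.

Lemma atom_eq_psubst a b A B k :
  atom_eq a b -> a <> PVar k -> pcong A B -> atom_eq (psubst k A a) (psubst k B b).
Proof.
  intros [] Hk HA; simpl;
    try (constructor; auto using pcong_psubst, pcong_vshift, pcong_pshift; fail).
  destruct (Nat.eqb_spec X k); [subst; tauto|]. destruct (k <? X); constructor.
Qed.

Lemma PermutationA_map_psubst L L' A B k :
  PermutationA atom_eq L L' -> pcong A B -> ~ In (PVar k) L ->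
  PermutationA atom_eq (map (psubst k A) L) (map (psubst k B) L').
Proof.
  intros H HA. assert (HB : pcong B B) by apply cc_refl.
  assert (HAA : pcong A A) by apply cc_refl.
  assert (Hin : forall L L', PermutationA atom_eq L L' -> ~ In (PVar k) L -> ~ In (PVar k) L').
  { clear. induction 1; simpl; auto.
    - intros H1 [H2|H2]; [subst; inversion H; subst|]; tauto.
    - tauto. }
  revert A B HA HB HAA.
  induction H as [|a b L L' Hab H IH|a b L|L1 L2 L3 H1 IH1 H2 IH2]; intros A B HA HB HAA Hk.
  - constructor.
  - simpl in *. constructor; auto using atom_eq_psubst.
  - simpl in *. etransitivity; [apply permA_swap|].
    assert (forall x, In x (a :: b :: L) -> atom_eq (psubst k A x) (psubst k B x)) as E.
    { intros x Hx. apply atom_eq_psubst; auto; [reflexivity|]. intros ->. simpl in *; tauto. }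
    simpl in E. do 2 (constructor; auto).
    assert (E' : forall x, In x L -> atom_eq (psubst k A x) (psubst k B x)) by auto.
    clear -E'. induction L; simpl in *; constructor; auto.
  (* The first half keeps [A] and only the second replaces it by [B]; [Hin] carries the side
     condition to the middle list. *)
  - etransitivity; [apply (IH1 A A)|]; eauto.
Qed.

(* Recursions must be guarded for [cc_mu]: [PMu (PVar 0)] has no summands. *)
Lemma summands_pcong P Q :
  pcong P Q -> guarded P -> forall L L', summands P L -> summands Q L' ->
  PermutationA atom_eq L L'.
Proof.
  induction 1 as [P Q []| | | P Q Q' H1 IH1 H2 IH2| | |P Q P' Q' H1 IH1 H2 IH2|
                 |P Q H IH]; intros HG L L' HL HL'.
  - inversion HL; subst. rewrite (summands_det _ _ H0 _ HL'). reflexivity.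
  - inversion HL; subst; inversion HL'; subst.
    rewrite (summands_det _ _ H1 _ H5), (summands_det _ _ H3 _ H2).
    apply PermutationA_app_comm; auto with typeclass_instances.
  - inversion HL as [| | | | |? ? L1 L2 HL1 HL2 |]; subst; inversion HL1; subst;
    inversion HL' as [| | | | |? ? L3 L4 HL3 HL4 |]; subst; inversion HL4; subst.
    repeat match goal with
    | H1 : summands ?P _, H2 : summands ?P _ |- _ =>
        rewrite (summands_det _ _ H1 _ H2) in *; clear H1
    end. rewrite app_assoc. reflexivity.
  - rewrite (summands_det _ _ HL _ HL'). reflexivity.
  - symmetry. apply IHcongruence_closure; auto. apply (guarded_pcong _ _ H); auto.
  (* Congruence preserves guardedness, so the middle process has summands through which to chain. *)
  - assert (HG2 : guarded Q) by (apply (guarded_pcong _ _ H1); auto).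
    destruct (summands_exist Q HG2) as [L0 HL0]. etransitivity; eauto.
  - inversion HL; subst; inversion HL'; subst. constructor; [constructor; auto | constructor].
  - inversion HL; subst; inversion HL'; subst. constructor; [constructor; auto | constructor].
  - destruct HG. inversion HL; subst; inversion HL'; subst.
    apply PermutationA_app; auto with typeclass_instances.
  - inversion HL; subst; inversion HL'; subst. constructor; [constructor; auto | constructor].
  (* Relate the summands of the two bodies, then substitute the two congruent recursions for the
     bound variable, which guardedness keeps out of the lists. *)
  - pose proof HG as [Hp HGP]. destruct (summands_exist P HGP) as [M HM].
    assert (HGQ : guarded Q) by (apply (guarded_pcong _ _ H); auto).
    destruct (summands_exist Q HGQ) as [M' HM'].
    rewrite (summands_det _ _ HL _ (summands_mu_intro _ _ Hp HM)).
    assert (Hp' : prefixed 0 Q) by (apply (prefixed_pcong _ _ H); auto).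
    rewrite (summands_det _ _ HL' _ (summands_mu_intro _ _ Hp' HM')).
    apply PermutationA_map_psubst; auto.
    + apply cc_mu; auto.
    + eapply summands_prefixed; eauto.
Qed.

(** * Session types *)

Lemma stype_nested_ind (P : stype -> Prop) :
  (forall p bs, (forall l S T, In (l, S, T) bs -> P T) -> P (TIn p bs)) ->
  (forall p bs, (forall l S T, In (l, S, T) bs -> P T) -> P (TOut p bs)) ->
  (forall T, P T -> P (TMu T)) -> (forall t, P (TVar t)) -> P TEnd ->
  forall T, P T.
Proof.
  intros Hin Hout Hmu Hvar Hend. fix IH 1. intros [p bs|p bs|T|t|];
  [apply Hin | apply Hout | apply Hmu, IH | apply Hvar | apply Hend];
  (induction bs as [|[[l' S'] T'] bs IHbs]; intros l S T; [intros [] |];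
   intros [E|H]; [injection E as <- <- <-; apply IH | apply (IHbs l S T H)]).
Qed.

Section BranchMap.
Context {A B : Type}.
Implicit Types (f g : A -> B) (bs : list (label * sort * A)).

Lemma in_branch_map f bs l S U :
  In (l, S, U) (map (fun '(l, s, U) => (l, s, f U)) bs) <->
  exists T, In (l, S, T) bs /\ U = f T.
Proof.
  rewrite in_map_iff. split.
  - intros ([[l' S'] T] & E & H). inversion E; subst; eauto.
  - intros (T & H & ->). exists (l, S, T); auto.
Qed.

Lemma labels_branch_map f bs : labels (map (fun '(l, s, U) => (l, s, f U)) bs) = labels bs.
Proof.
  unfold labels. rewrite map_map. apply map_ext. intros [[l S] T]; auto.
Qed.
End BranchMap.

Lemma in_labels {A} l S (T : A) bs : In (l, S, T) bs -> In l (labels bs).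
Proof. intros H. apply (in_map (fun b => fst (fst b)) _ _ H). Qed.

Lemma NoDup_labels_unique {A} (bs : list (label * sort * A)) l S S' T T' :
  NoDup (labels bs) -> In (l, S, T) bs -> In (l, S', T') bs -> S = S' /\ T = T'.
Proof.
  induction bs as [|[[l0 S0] T0] bs IH]; simpl; [tauto|].
  intros HN; inversion HN as [|? ? Hn HN']; subst. intros [E|H] [E'|H'].
  - rewrite E' in E; injection E; auto.
  - injection E as -> -> ->. apply in_labels in H'. tauto.
  - injection E' as -> -> ->. apply in_labels in H. tauto.
  - auto.
Qed.

Ltac branch_cases :=
  rewrite ?map_map; f_equal; apply map_ext_in; intros [[l0 S0] T0] HT0; f_equal; eauto.

Lemma tshift_tshift T : forall i j, i <= j -> tshift (S j) (tshift i T) = tshift i (tshift j T).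
Proof.
  induction T using stype_nested_ind; simpl; intros i j Hij; try branch_cases.
  - f_equal. apply IHT; lia.
  - index_cases.
  - auto.
Qed.

Lemma tsubst_tshift T : forall i j V,
  j <= i -> tsubst (S i) (tshift j V) (tshift j T) = tshift j (tsubst i V T).
Proof.
  induction T using stype_nested_ind; simpl; intros i j V Hij; try branch_cases.
  - f_equal. rewrite <- tshift_tshift, IHT by lia; auto.
  - index_cases; f_equal; lia.
  - auto.
Qed.

Lemma tsubst_tshift_cancel T : forall j V, tsubst j V (tshift j T) = T.
Proof.
  induction T using stype_nested_ind; simpl; intros j V.
  - f_equal. rewrite map_map. rewrite <- map_id. apply map_ext_in.
    intros [[l0 S0] T0] HT0. rewrite (H _ _ _ HT0); auto.
  - f_equal. rewrite map_map. rewrite <- map_id. apply map_ext_in.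
    intros [[l0 S0] T0] HT0. rewrite (H _ _ _ HT0); auto.
  - f_equal; auto.
  - index_cases.
  - auto.
Qed.

Lemma tsubst_tsubst T : forall i j V W,
  j <= i ->
  tsubst i W (tsubst j V T) = tsubst j (tsubst i W V) (tsubst (S i) (tshift j W) T).
Proof.
  induction T using stype_nested_ind; simpl; intros i j V W Hij; try branch_cases.
  - f_equal. rewrite IHT by lia. rewrite tsubst_tshift, tshift_tshift by lia; auto.
  - index_cases; rewrite ?tsubst_tshift_cancel; auto; f_equal; lia.
  - auto.
Qed.

Lemma tprefixed_tshift_eq T : forall k, tprefixed k (tshift k T).
Proof. induction T; simpl; auto. intros; index_cases. Qed.

Lemma tprefixed_tshift_lt T : forall k j,
  k < j -> (tprefixed k (tshift j T) <-> tprefixed k T).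
Proof.
  induction T; simpl; intros; try tauto.
  - apply IHT; lia.
  - index_cases; lia.
Qed.

Lemma tprefixed_tshift_ge T : forall k j,
  j <= k -> (tprefixed (S k) (tshift j T) <-> tprefixed k T).
Proof.
  induction T; simpl; intros; try tauto.
  - apply IHT; lia.
  - index_cases; lia.
Qed.

Lemma tprefixed_tsubst_ge T : forall k j V,
  j <= k ->
  (tprefixed k (tsubst j V T) <-> tprefixed (S k) T /\ (tprefixed j T \/ tprefixed k V)).
Proof.
  induction T; simpl; intros; try tauto.
  - rewrite IHT, tprefixed_tshift_ge by lia; tauto.
  - index_cases; lia || (split; intros; [split; [lia|right; auto]|tauto]).
Qed.

Lemma tprefixed_tsubst_lt T : forall k j V,
  k < j ->
  (tprefixed k (tsubst j V T) <-> tprefixed k T /\ (tprefixed j T \/ tprefixed k V)).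
Proof.
  induction T; simpl; intros; try tauto.
  - rewrite IHT, tprefixed_tshift_ge by lia; tauto.
  - index_cases; lia || (split; intros; [split; [lia|right; auto]|tauto]).
Qed.

Lemma tprefixed_dec k T : tprefixed k T \/ ~ tprefixed k T.
Proof. revert k; induction T; simpl; auto. intros; lia. Qed.

Lemma map_nonempty {A B} (f : A -> B) l : l <> [] -> map f l <> [].
Proof. destruct l; simpl; congruence. Qed.

Lemma twf_tshift n T : twf n T -> forall k, k <= n -> twf (S n) (tshift k T).
Proof.
  induction 1 as [n p bs Hn HN H IH|n p bs Hn HN H IH|n T Hp H IH|n t Ht|n];
  intros k Hk; simpl.
  - constructor; [apply map_nonempty; auto | rewrite labels_branch_map; auto|].
    intros l S U HU. apply in_branch_map in HU as (T & HT & ->). eauto.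
  - constructor; [apply map_nonempty; auto | rewrite labels_branch_map; auto|].
    intros l S U HU. apply in_branch_map in HU as (T & HT & ->). eauto.
  - constructor; [apply tprefixed_tshift_lt; auto; lia | apply IH; lia].
  - index_cases; constructor; lia.
  - constructor.
Qed.

Lemma twf_tsubst m T : twf m T -> forall n k V,
  m = S n -> twf n V -> k <= n -> twf n (tsubst k V T).
Proof.
  induction 1 as [m p bs Hn HN H IH|m p bs Hn HN H IH|m T Hp H IH|m t Ht|m];
  intros n k V -> HV Hk; simpl.
  - constructor; [apply map_nonempty; auto | rewrite labels_branch_map; auto|].
    intros l S U HU. apply in_branch_map in HU as (T & HT & ->). eauto.
  - constructor; [apply map_nonempty; auto | rewrite labels_branch_map; auto|].
    intros l S U HU. apply in_branch_map in HU as (T & HT & ->). eauto.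
  - constructor.
    + apply tprefixed_tsubst_lt; [lia|]. split; auto. right. apply tprefixed_tshift_eq.
    + apply IH; auto; [apply twf_tshift; auto|]; lia.
  - index_cases; constructor; lia.
  - constructor.
Qed.

Lemma tshift_closed n T : twf n T -> forall k, n <= k -> tshift k T = T.
Proof.
  induction 1 as [n p bs Hn HN H IH|n p bs Hn HN H IH|n T Hp H IH|n t Ht|n];
  intros k Hk; simpl.
  - f_equal. rewrite <- map_id. apply map_ext_in. intros [[l S] T] HT. f_equal; eauto.
  - f_equal. rewrite <- map_id. apply map_ext_in. intros [[l S] T] HT. f_equal; eauto.
  - f_equal. apply IH; lia.
  - index_cases.
  - auto.
Qed.

Lemma unfolds_det T U : unfolds T U -> forall U', unfolds T U' -> U = U'.
Proof.
  induction 1 as [T H|T U H IH]; intros U' H'; inversion H'; subst; auto.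
  - destruct (H T0); auto.
  - destruct (H0 T); auto.
Qed.

Lemma unfolds_not_mu T U : unfolds T U -> forall V, U <> TMu V.
Proof. induction 1; auto. Qed.

Lemma unfolds_in p bs : unfolds (TIn p bs) (TIn p bs).
Proof. constructor; discriminate. Qed.

Lemma unfolds_out p bs : unfolds (TOut p bs) (TOut p bs).
Proof. constructor; discriminate. Qed.

Lemma unfolds_end : unfolds TEnd TEnd.
Proof. constructor; discriminate. Qed.

Lemma unfolds_var_inv T U k : unfolds T U -> ~ tprefixed k T -> U = TVar k.
Proof.
  induction 1 as [T H|T U H IH]; intros Hk.
  - destruct T; simpl in Hk; try tauto.
    + destruct (H T); auto.
    + f_equal; lia.
  - apply IH. rewrite tprefixed_tsubst_ge by lia. simpl in *; tauto.
Qed.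

Lemma unfolds_var T k : unfolds T (TVar k) -> ~ tprefixed k T.
Proof.
  intros H; remember (TVar k) as U eqn:E. induction H; subst.
  - simpl; lia.
  - specialize (IHunfolds eq_refl). rewrite tprefixed_tsubst_ge in IHunfolds by lia.
    simpl in *; tauto.
Qed.

Lemma unfolds_tsubst T U k V :
  unfolds T U -> U <> TVar k -> unfolds (tsubst k V T) (tsubst k V U).
Proof.
  intros H; revert k V. induction H as [T H|T U H IH]; intros k V Hk.
  - constructor. intros U E. destruct T; simpl in E; try discriminate.
    + destruct (H T); auto.
    + revert E; index_cases; intros E; subst; congruence.
  - simpl. constructor. specialize (IH k V Hk). rewrite tsubst_tsubst in IH by lia. exact IH.
Qed.

Lemma unfolds_tsubst_var T k V Y :
  unfolds T (TVar k) -> unfolds V Y -> unfolds (tsubst k V T) Y.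
Proof.
  intros H HV; remember (TVar k) as U eqn:E. revert k V E HV.
  induction H as [T H|T U H IH]; intros k V E HV; subst.
  - simpl. index_cases.
  - simpl. constructor. specialize (IH k V eq_refl HV).
    rewrite tsubst_tsubst in IH by lia. exact IH.
Qed.

(** Contractiveness keeps the bound variable off the head of the body, so the head normal form of
    the body survives the substitution of the recursion. *)
Lemma unfolds_exist n T : twf n T -> exists U, unfolds T U.
Proof.
  induction 1 as [n p bs Hn HN H IH|n p bs Hn HN H IH|n T Hp H [U IH]|n t Ht|n];
  try (eexists; constructor; discriminate).
  exists (tsubst 0 (TMu T) U). constructor. apply unfolds_tsubst; auto.
  intros ->. apply unfolds_var in IH. tauto.
Qed.

Lemma unfolds_twf T U : unfolds T U -> forall n, twf n T -> twf n U.
Proof.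
  induction 1 as [T H|T U H IH]; intros n HT; auto.
  apply IH. inversion HT; subst. eapply twf_tsubst; eauto; lia.
Qed.

Lemma twf_in_inv T n p bs :
  twf n T -> unfolds T (TIn p bs) ->
  bs <> [] /\ NoDup (labels bs) /\ forall l S U, In (l, S, U) bs -> twf n U.
Proof. intros HT HU. apply (unfolds_twf _ _ HU) in HT. inversion HT; subst; auto. Qed.

Lemma twf_out_inv T n p bs :
  twf n T -> unfolds T (TOut p bs) ->
  bs <> [] /\ NoDup (labels bs) /\ forall l S U, In (l, S, U) bs -> twf n U.
Proof. intros HT HU. apply (unfolds_twf _ _ HU) in HT. inversion HT; subst; auto. Qed.

(** * Coinductive subtyping and type equality *)

Lemma subtype_step_mono (R R' : stype -> stype -> Prop) T T' :
  (forall U U', R U U' -> R' U U') -> subtype_step R T T' -> subtype_step R' T T'.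
Proof.
  intros HR []; [eapply subtype_step_end | eapply subtype_step_in | eapply subtype_step_out];
  eauto; intros l S U HU; destruct (H1 _ _ _ HU) as (S' & U' & ? & ? & ?); eauto 6.
Qed.

Lemma subtype_unfold T T' : subtype T T' -> subtype_step subtype T T'.
Proof.
  intros (R & HR & HT). eapply subtype_step_mono; [|apply HR, HT].
  intros U U' HU. exists R; auto.
Qed.

Lemma subtype_coind (R : stype -> stype -> Prop) :
  (forall T T', R T T' -> subtype_step R T T') -> forall T T', R T T' -> subtype T T'.
Proof. intros HR T T' HT. exists R; auto. Qed.

Lemma subtype_fold T T' : subtype_step subtype T T' -> subtype T T'.
Proof.
  intros H. apply (subtype_coind (fun T T' => subtype_step subtype T T')); auto.
  intros U U' HU. eapply subtype_step_mono; [|exact HU]. apply subtype_unfold.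
Qed.

Lemma subtype_trans T1 T2 T3 : subtype T1 T2 -> subtype T2 T3 -> subtype T1 T3.
Proof.
  intros H12 H23.
  apply (subtype_coind (fun T1 T3 => exists T2, subtype T1 T2 /\ subtype T2 T3)); [|eauto].
  clear. intros T1 T3 (T2 & H12 & H23).
  apply subtype_unfold in H12, H23.
  destruct H12 as [H1 H2|p bs1 bs2 H1 H2 H12|p bs1 bs2 H1 H2 H12],
           H23 as [H3 H4|p' bs3 bs4 H3 H4 H34|p' bs3 bs4 H3 H4 H34];
  pose proof (unfolds_det _ _ H2 _ H3) as E; inversion E; subst; clear E.
  - apply subtype_step_end; auto.
  - eapply subtype_step_in; eauto. intros l S' U' HU'.
    destruct (H34 _ _ _ HU') as (S2 & U2 & HU2 & ? & ?).
    destruct (H12 _ _ _ HU2) as (S1 & U1 & HU1 & ? & ?). eauto 8 using subsort_trans.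
  - eapply subtype_step_out; eauto. intros l S' U' HU'.
    destruct (H12 _ _ _ HU') as (S2 & U2 & HU2 & ? & ?).
    destruct (H34 _ _ _ HU2) as (S1 & U1 & HU1 & ? & ?). eauto 8 using subsort_trans.
Qed.

Lemma teq_unfold T T' : teq T T' -> teq_step teq T T'.
Proof.
  intros (R & HR & HT).
  assert (Hb : forall bs bs', teq_branches R bs bs' -> teq_branches teq bs bs').
  { intros bs bs' [H1 H2]; split; intros l S U HU;
    [destruct (H1 _ _ _ HU) as (U' & ? & ?) | destruct (H2 _ _ _ HU) as (U' & ? & ?)];
    exists U'; split; auto; exists R; auto. }
  destruct (HR _ _ HT);
  [eapply teq_step_end | eapply teq_step_var | eapply teq_step_in | eapply teq_step_out]; eauto.
Qed.

Lemma teq_refl n T : twf n T -> teq T T.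
Proof.
  intros HT. exists (fun U U' => U = U' /\ twf n U). split; [|auto].
  clear. intros U U' [<- HT]. destruct (unfolds_exist _ _ HT) as [X HX].
  assert (HW := unfolds_twf _ _ HX _ HT). destruct X.
  - eapply teq_step_in; eauto. inversion HW; subst. split; eauto 6.
  - eapply teq_step_out; eauto. inversion HW; subst. split; eauto 6.
  - destruct (unfolds_not_mu _ _ HX X); auto.
  - eapply teq_step_var; eauto.
  - eapply teq_step_end; eauto.
Qed.

Lemma teq_sym T T' : teq T T' -> teq T' T.
Proof.
  intros H. exists (fun T T' => teq T' T). split; auto. clear. intros T T' H.
  destruct (teq_unfold _ _ H);
  [eapply teq_step_end | eapply teq_step_var | eapply teq_step_in | eapply teq_step_out]; eauto;
  destruct H2; split; auto.
Qed.

(** Closedness rules out the variable case, which [teq_step] has and [subtype_step] lacks. *)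
Lemma teq_subtype T T' : twf 0 T -> twf 0 T' -> teq T T' -> subtype T T'.
Proof.
  intros HT HT' H.
  apply (subtype_coind (fun T T' => twf 0 T /\ twf 0 T' /\ teq T T')); [|auto]. clear.
  intros T T' (HT & HT' & H). apply teq_unfold in H.
  destruct H as [H H'|t H H'|p bs bs' H H' [Hb Hb']|p bs bs' H H' [Hb Hb']].
  - apply subtype_step_end; auto.
  - apply (unfolds_twf _ _ H) in HT. inversion HT; lia.
  - apply (twf_in_inv _ _ _ _ HT) in H as HW.
    apply (twf_in_inv _ _ _ _ HT') in H' as HW'. destruct HW as (_ & _ & HW), HW' as (_ & _ & HW').
    eapply subtype_step_in; eauto. intros l S U' HU'.
    destruct (Hb' _ _ _ HU') as (U & HU & ?). exists S, U.
    eauto 8 using subsort_refl.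
  - apply (twf_out_inv _ _ _ _ HT) in H as HW.
    apply (twf_out_inv _ _ _ _ HT') in H' as HW'. destruct HW as (_ & _ & HW), HW' as (_ & _ & HW').
    eapply subtype_step_out; eauto. intros l S U HU.
    destruct (Hb _ _ _ HU) as (U' & HU' & ?). exists S, U'.
    eauto 8 using subsort_refl.
Qed.

Lemma subtype_refl T : twf 0 T -> subtype T T.
Proof. intros HT. apply teq_subtype; eauto using teq_refl. Qed.

Lemma subtype_in_incl T q bs bs' :
  twf 0 T -> unfolds T (TIn q bs') -> incl bs' bs -> subtype (TIn q bs) T.
Proof.
  intros HT HU Hi. apply subtype_fold. eapply subtype_step_in; eauto using unfolds_in.
  destruct (twf_in_inv _ _ _ _ HT HU) as (_ & _ & HW).
  intros l S U HU'. exists S, U. split; [apply Hi; auto|].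
  eauto using subsort_refl, subtype_refl.
Qed.

Lemma subtype_out_incl T q bs bs' :
  twf 0 T -> unfolds T (TOut q bs') -> incl bs' bs -> subtype T (TOut q bs).
Proof.
  intros HT HU Hi. apply subtype_fold. eapply subtype_step_out; eauto using unfolds_out.
  destruct (twf_out_inv _ _ _ _ HT HU) as (_ & _ & HW).
  intros l S U HU'. exists S, U. split; [apply Hi; auto|].
  eauto using subsort_refl, subtype_refl.
Qed.

Lemma subtype_end_inv T T' : subtype T T' -> unfolds T' TEnd -> unfolds T TEnd.
Proof.
  intros H HE. destruct (subtype_unfold _ _ H) as [|p bs bs' H1 H2|p bs bs' H1 H2]; auto;
  pose proof (unfolds_det _ _ HE _ H2); discriminate.
Qed.

Lemma subtype_in_inv T T' q bs' :
  subtype T T' -> unfolds T' (TIn q bs') ->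
  exists bs, unfolds T (TIn q bs) /\
    forall l S' U', In (l, S', U') bs' ->
      exists S U, In (l, S, U) bs /\ subsort S' S /\ subtype U U'.
Proof.
  intros H HE. destruct (subtype_unfold _ _ H) as [|p bs bs'' H1 H2|p bs bs'' H1 H2]; auto;
  assert (E := unfolds_det _ _ HE _ ltac:(eassumption)); inversion E; subst; eauto.
Qed.

Lemma subtype_out_inv T T' q bs' :
  subtype T T' -> unfolds T' (TOut q bs') ->
  exists bs, unfolds T (TOut q bs) /\
    forall l S U, In (l, S, U) bs ->
      exists S' U', In (l, S', U') bs' /\ subsort S S' /\ subtype U U'.
Proof.
  intros H HE. destruct (subtype_unfold _ _ H) as [|p bs bs'' H1 H2|p bs bs'' H1 H2]; auto;
  assert (E := unfolds_det _ _ HE _ ltac:(eassumption)); inversion E; subst; eauto.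
Qed.

(** * Typed processes *)

Lemma input_sum_map q (f g : proc -> proc) P bs :
  (forall l P, f (PIn q l P) = PIn q l (g P)) ->
  (forall P Q, f (PSum P Q) = PSum (f P) (f Q)) ->
  input_sum q P bs -> input_sum q (f P) (map (fun '(l, Q) => (l, g Q)) bs).
Proof.
  intros Hin Hsum. induction 1; rewrite ?Hin, ?Hsum, ?map_app; simpl; constructor; auto.
Qed.

Lemma input_sum_nonempty q P bs : input_sum q P bs -> bs <> [].
Proof. induction 1; [discriminate|]. intros E; apply app_eq_nil in E; tauto. Qed.

Lemma input_sum_summands q P bs :
  input_sum q P bs -> summands P (map (fun '(l, Q) => PIn q l Q) bs).
Proof. induction 1; rewrite ?map_app; simpl; constructor; auto. Qed.

(** [red_comm] asks for a literal sum of inputs, while typing only controls summands; unfolding the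
    recursions met along the sum passes from one to the other. *)
Lemma summands_input_sum q P L :
  summands P L -> (forall a, In a L -> exists l Q, a = PIn q l Q) ->
  exists P' bs, pcong P P' /\ input_sum q P' bs /\ L = map (fun '(l, Q) => PIn q l Q) bs.
Proof.
  induction 1 as [p l P|p l e P|e P Q|X| |P Q L L' H1 IH1 H2 IH2|P L H IH]; intros HL;
  try (destruct (HL _ (or_introl eq_refl)) as (? & ? & E); inversion E; subst; clear E).
  - exists (PIn q x x0), [(x, x0)]. repeat split; [apply cc_refl | constructor].
  - destruct IH1 as (P' & bs1 & HP & HS & ->); [intros; apply HL, in_app_iff; auto|].
    destruct IH2 as (Q' & bs2 & HQ & HS' & ->); [intros; apply HL, in_app_iff; auto|].
    exists (PSum P' Q'), (bs1 ++ bs2). rewrite map_app. repeat split.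
    + apply cc_sum; auto.
    + constructor; auto.
  - destruct (IH HL) as (P' & bs & HP & HS & ->). exists P', bs. repeat split; auto.
    eapply cc_trans; [apply cc_base; constructor | exact HP].
Qed.

(** The input case shared by the shift and substitution lemmas for typing: [f] acts on the sum, and
    [g] is the same operation under the binder of an input. *)
Lemma ptyped_in_map Gamma Delta q P (bs : list (label * sort * proc * stype)) (f g : proc -> proc) :
  (forall l P, f (PIn q l P) = PIn q l (g P)) ->
  (forall P Q, f (PSum P Q) = PSum (f P) (f Q)) ->
  input_sum q P (map (fun '(l, _, Q, _) => (l, Q)) bs) ->
  NoDup (map (fun '(l, _, _, _) => l) bs) ->
  (forall l S Q T, In (l, S, Q, T) bs -> ptyped (S :: Gamma) Delta (g Q) T) ->
  ptyped Gamma Delta (f P) (TIn q (map (fun '(l, s, _, T) => (l, s, T)) bs)).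
Proof.
  intros Hf Hs HI HN HT.
  replace (map (fun '(l, s, _, T) => (l, s, T)) bs)
    with (map (fun '(l, s, _, T) => (l, s, T)) (map (fun '(l, s, Q, T) => (l, s, g Q, T)) bs))
    by (rewrite map_map; apply map_ext; intros [[[? ?] ?] ?]; auto).
  constructor.
  - apply (input_sum_map q f g _ _ Hf Hs) in HI. rewrite map_map in *.
    erewrite map_ext; [exact HI|]. intros [[[? ?] ?] ?]; auto.
  - rewrite map_map. erewrite map_ext; [exact HN|]. intros [[[? ?] ?] ?]; auto.
  - intros l S Q T H. apply in_map_iff in H as ([[[l0 S0] Q0] T0] & E & H).
    injection E as <- <- <- <-. eauto.
Qed.

Lemma ptyped_vshift Gamma Delta P T S0 : ptyped Gamma Delta P T ->
  forall Gamma1 Gamma2, Gamma = Gamma1 ++ Gamma2 ->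
  ptyped (Gamma1 ++ S0 :: Gamma2) Delta (vshift (length Gamma1) P) T.
Proof.
  induction 1; intros Gamma1 Gamma2 ->.
  - eapply (ptyped_in_map _ _ _ _ _ _ (vshift (S (length Gamma1)))); eauto.
    intros l S Q T HQ. apply (H2 _ _ _ _ HQ (S :: Gamma1) Gamma2); auto.
  - constructor.
  - simpl. constructor; auto using etyped_eshift.
  - simpl. econstructor; eauto using etyped_eshift.
  - simpl. constructor; auto.
  - constructor; auto.
  - eapply ptyped_sub; eauto.
  - eapply ptyped_unfold; eauto. apply cc_vshift; auto using unfold_axiom_vshift.
Qed.

Lemma ptyped_vsubst Gamma Delta P T S0 v : has_sort v S0 -> ptyped Gamma Delta P T ->
  forall Gamma1 Gamma2, Gamma = Gamma1 ++ S0 :: Gamma2 ->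
  ptyped (Gamma1 ++ Gamma2) Delta (vsubst (length Gamma1) v P) T.
Proof.
  intros Hv. induction 1; intros Gamma1 Gamma2 ->.
  - eapply (ptyped_in_map _ _ _ _ _ _ (vsubst (S (length Gamma1)) v)); eauto.
    intros l S Q T HQ. apply (H2 _ _ _ _ HQ (S :: Gamma1) Gamma2); auto.
  - constructor.
  - simpl. constructor; eauto using etyped_esubst.
  - simpl. econstructor; eauto using etyped_esubst.
  - simpl. constructor; auto.
  - constructor; auto.
  - eapply ptyped_sub; eauto.
  - eapply ptyped_unfold; eauto. apply cc_vsubst; auto using unfold_axiom_vsubst.
Qed.

Lemma ptyped_pshift Gamma Delta P T T0 : ptyped Gamma Delta P T ->
  forall Delta1 Delta2, Delta = Delta1 ++ Delta2 ->
  ptyped Gamma (Delta1 ++ T0 :: Delta2) (pshift (length Delta1) P) T.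
Proof.
  induction 1; intros Delta1 Delta2 ->.
  - eapply (ptyped_in_map _ _ _ _ _ _ (pshift (length Delta1))); eauto.
  - constructor.
  - simpl. constructor; auto.
  - simpl. econstructor; eauto.
  - simpl. constructor; auto. apply (IHptyped (T :: Delta1) Delta2); auto.
  - simpl. destruct (Nat.ltb_spec X (length Delta1)); constructor.
    + rewrite nth_error_app1 in * by lia; auto.
    + rewrite nth_error_app2 in * by lia.
      replace (S X - length Delta1) with (S (X - length Delta1)) by lia; auto.
  - eapply ptyped_sub; eauto.
  - eapply ptyped_unfold; eauto. apply cc_pshift; auto using unfold_axiom_pshift.
Qed.

Lemma ptyped_psubst Gamma Delta P T T0 : ptyped Gamma Delta P T ->
  forall Delta1 Delta2 A, Delta = Delta1 ++ T0 :: Delta2 ->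
  ptyped Gamma (Delta1 ++ Delta2) A T0 ->
  ptyped Gamma (Delta1 ++ Delta2) (psubst (length Delta1) A P) T.
Proof.
  induction 1; intros Delta1 Delta2 A -> HA.
  - eapply (ptyped_in_map _ _ _ _ _ _ (psubst (length Delta1) (vshift 0 A))); eauto.
    intros l S Q T HQ. eapply H2; eauto. apply (ptyped_vshift _ _ _ _ S HA []); auto.
  - constructor.
  - simpl. constructor; auto.
  - simpl. econstructor; eauto.
  - simpl. constructor; auto. apply (IHptyped (T :: Delta1) Delta2); auto.
    apply (ptyped_pshift _ _ _ _ T HA []); auto.
  - simpl. destruct (Nat.eqb_spec X (length Delta1)); [|destruct (Nat.ltb_spec (length Delta1) X)].
    + subst. rewrite nth_error_app2, Nat.sub_diag in H by lia. injection H as <-. auto.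
    + constructor. rewrite nth_error_app2 in * by lia. destruct X; [lia|]. simpl.
      replace (S X - length Delta1) with (S (X - length Delta1)) in H by lia. auto.
    + constructor. rewrite nth_error_app1 in * by lia; auto.
  - eapply ptyped_sub; eauto.
  - eapply ptyped_unfold; eauto. apply cc_psubst; auto using unfold_axiom_psubst.
Qed.

Lemma labels_app {A} (bs bs' : list (label * sort * A)) :
  labels (bs ++ bs') = labels bs ++ labels bs'.
Proof. apply map_app. Qed.

Lemma NoDup_labels_app {A} (bs bs' : list (label * sort * A)) :
  NoDup (labels bs) -> NoDup (labels bs') -> disjoint_labels bs bs' -> NoDup (labels (bs ++ bs')).
Proof.
  intros H H' Hd. rewrite labels_app. apply NoDup_app; auto.
Qed.

Lemma union_type_twf T1 T2 T : union_type T1 T2 T -> twf 0 T1 -> twf 0 T2 -> twf 0 T.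
Proof.
  intros [|q bs1 bs2 H1 H2 Hd] W1 W2; auto.
  destruct (twf_out_inv _ _ _ _ W1 H1) as (? & ? & ?), (twf_out_inv _ _ _ _ W2 H2) as (? & ? & ?).
  constructor.
  - destruct bs1; simpl; congruence.
  - apply NoDup_labels_app; auto.
  - intros l S U HU. apply in_app_iff in HU as [|]; eauto.
Qed.

(** Lets both branches of a conditional take the type of the whole by subsumption, so the inversion
    in [shape] needs no partial union. *)
Lemma union_type_subtype T1 T2 T :
  union_type T1 T2 T -> twf 0 T1 -> twf 0 T2 -> subtype T1 T /\ subtype T2 T.
Proof.
  intros [H|q bs1 bs2 H1 H2 Hd] W1 W2.
  - split; [apply subtype_refl | apply teq_subtype]; auto using teq_sym.
  - split; eapply subtype_out_incl; eauto; intros ? ?; apply in_app_iff; auto.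
Qed.

Lemma ptyped_twf Gamma Delta P T : ptyped Gamma Delta P T -> Forall (twf 0) Delta -> twf 0 T.
Proof.
  induction 1; intros HD; auto.
  - constructor.
    + apply input_sum_nonempty in H. destruct bs; simpl in *; congruence.
    + unfold labels. rewrite map_map. erewrite map_ext; [exact H0|]. intros [[[? ?] ?] ?]; auto.
    + intros l S T HT. apply in_map_iff in HT as ([[[l0 S0] Q0] T0] & E & HT).
      injection E as <- <- <-. eauto.
  - constructor.
  - constructor; [discriminate| |].
    + repeat constructor. simpl; tauto.
    + intros l0 S0 T0 [E|[]]. injection E as <- <- <-; auto.
  - eapply union_type_twf; eauto.
  - rewrite Forall_forall in HD. apply HD. eapply nth_error_In; eauto.
Qed.

(** * Inversion of typing *)

(* Typing up to subsumption and structural congruence, which makes it invariant under both. *)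
Definition gtyped (Gamma : list sort) (Delta : list stype) (P : proc) (T : stype) : Prop :=
  exists P0 T0, ptyped Gamma Delta P0 T0 /\ guarded P0 /\ subtype T0 T /\ pcong P0 P.

Lemma gtyped_sub Gamma Delta P T T' :
  gtyped Gamma Delta P T -> subtype T T' -> gtyped Gamma Delta P T'.
Proof.
  intros (P0 & T0 & ? & ? & ? & ?) ?. exists P0, T0. eauto using subtype_trans.
Qed.

Lemma gtyped_pcong Gamma Delta P Q T :
  gtyped Gamma Delta P T -> pcong P Q -> gtyped Gamma Delta Q T.
Proof.
  intros (P0 & T0 & ? & ? & ? & ?) ?. exists P0, T0. repeat split; auto.
  eapply cc_trans; eauto.
Qed.

Lemma gtyped_vsubst Gamma Delta P T S v :
  gtyped (S :: Gamma) Delta P T -> has_sort v S -> gtyped Gamma Delta (vsubst 0 v P) T.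
Proof.
  intros (P0 & T0 & H & HG & HS & HC) Hv. exists (vsubst 0 v P0), T0. repeat split; auto.
  - apply (ptyped_vsubst _ _ _ _ _ _ Hv H []); auto.
  - apply guarded_vsubst; auto.
  - apply pcong_vsubst; auto.
Qed.

Lemma gtyped_psubst Gamma Delta P T T0 A :
  gtyped Gamma (T0 :: Delta) P T -> ptyped Gamma Delta A T0 -> guarded A ->
  gtyped Gamma Delta (psubst 0 A P) T.
Proof.
  intros (P0 & T1 & H & HG & HS & HC) HA HGA. exists (psubst 0 A P0), T1. repeat split; auto.
  - apply (ptyped_psubst _ _ _ _ T0 H [] Delta); auto.
  - apply guarded_psubst; auto.
  - apply pcong_psubst; auto. apply cc_refl.
Qed.

Lemma gtyped_intro Gamma Delta P T :
  ptyped Gamma Delta P T -> Forall (twf 0) Delta -> guarded P -> gtyped Gamma Delta P T.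
Proof.
  intros H HD HG. exists P, T. repeat split; auto.
  - apply subtype_refl. eapply ptyped_twf; eauto.
  - apply cc_refl.
Qed.

(** The inversion principle of typing, phrased on top-level summands. [shape_in] constrains only
    summands whose label is in [bs], as input subsumption may leave others behind; quantifying over
    every summand with a given label makes the rule stable under permutation. [shape_var] serves
    open processes, met inside recursions. *)
Inductive shape (Gamma : list sort) (Delta : list stype) : list proc -> stype -> Prop :=
| shape_nil T : unfolds T TEnd -> shape Gamma Delta [PNil] T
| shape_out q l e P T bs S U :
    unfolds T (TOut q bs) -> In (l, S, U) bs -> etyped Gamma e S -> gtyped Gamma Delta P U ->
    shape Gamma Delta [POut q l e P] T
| shape_if e P1 P2 T :
    etyped Gamma e SBool -> gtyped Gamma Delta P1 T -> gtyped Gamma Delta P2 T ->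
    shape Gamma Delta [PIf e P1 P2] T
| shape_in q L T bs :
    unfolds T (TIn q bs) -> L <> [] ->
    (forall a, In a L -> exists l P, a = PIn q l P) ->
    (forall l S U, In (l, S, U) bs -> exists P, In (PIn q l P) L) ->
    (forall l S U P, In (l, S, U) bs -> In (PIn q l P) L ->
       exists S0, subsort S S0 /\ gtyped (S0 :: Gamma) Delta P U) ->
    shape Gamma Delta L T
| shape_var X T T0 :
    nth_error Delta X = Some T0 -> subtype T0 T -> shape Gamma Delta [PVar X] T.

Lemma shape_sub Gamma Delta L T T' :
  shape Gamma Delta L T -> subtype T T' -> shape Gamma Delta L T'.
Proof.
  intros H HS. pose proof (subtype_unfold _ _ HS) as HS'.
  destruct H as [T HU|q l e P T bs S U HU HI HE HP|e P1 P2 T HE HP1 HP2|q L T bs HU HL HA HB HC|].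
  - destruct HS' as [H1 H2|p bs bs' H1 H2 H3|p bs bs' H1 H2 H3];
    pose proof (unfolds_det _ _ HU _ H1) as E; inversion E; subst. constructor; auto.
  - destruct HS' as [H1 H2|p bs1 bs' H1 H2 H3|p bs1 bs' H1 H2 H3];
    pose proof (unfolds_det _ _ HU _ H1) as E; inversion E; subst.
    destruct (H3 _ _ _ HI) as (S' & U' & HI' & HSS & HUU).
    econstructor; eauto using et_sub, gtyped_sub.
  - constructor; eauto using gtyped_sub.
  - destruct HS' as [H1 H2|p bs1 bs' H1 H2 H3|p bs1 bs' H1 H2 H3];
    pose proof (unfolds_det _ _ HU _ H1) as E; inversion E; subst.
    eapply shape_in; eauto.
    + intros l S' U' HI. destruct (H3 _ _ _ HI) as (S & U & HI' & HSS & HUU). eauto.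
    + intros l S' U' P HI HP. destruct (H3 _ _ _ HI) as (S & U & HI' & HSS & HUU).
      destruct (HC _ _ _ _ HI' HP) as (S0 & ? & ?).
      exists S0. eauto using subsort_trans, gtyped_sub.
  - eapply shape_var; eauto using subtype_trans.
Qed.

Lemma PermutationA_singleton a L :
  PermutationA atom_eq [a] L -> exists b, L = [b] /\ atom_eq a b.
Proof.
  intros H. remember [a] as M eqn:E. revert a E.
  induction H as [|x y L L' Hxy H IH|x y L|L1 L2 L3 H1 IH1 H2 IH2]; intros a E; inversion E; subst.
  - exists y. split; auto. f_equal.
    assert (HL : forall M N, PermutationA atom_eq M N -> M = [] -> N = []).
    { clear. induction 1; intros; auto; discriminate. }
    eauto.
  - destruct (IH1 a eq_refl) as (b & -> & Hb). destruct (IH2 b eq_refl) as (c & -> & Hc).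
    exists c; split; auto. etransitivity; eauto.
Qed.

Lemma PermutationA_In L L' a :
  PermutationA atom_eq L L' -> In a L -> exists b, In b L' /\ atom_eq a b.
Proof.
  intros H; revert a. induction H as [|x y L L' Hxy H IH|x y L|L1 L2 L3 H1 IH1 H2 IH2];
  simpl; intros a Ha.
  - tauto.
  - destruct Ha as [->|Ha]; [eauto|]. destruct (IH a Ha) as (b & ? & ?); eauto.
  - exists a. split; [tauto|reflexivity].
  - destruct (IH1 a Ha) as (b & Hb & ?). destruct (IH2 b Hb) as (c & Hc & ?).
    exists c. split; auto. etransitivity; eauto.
Qed.

Lemma shape_perm Gamma Delta L L' T :
  shape Gamma Delta L T -> PermutationA atom_eq L L' -> shape Gamma Delta L' T.
Proof.
  intros [T' HU|q l e P T' bs S U HU HI HE HP|e P1 P2 T' HE HP1 HP2|q M T' bs HU HL HA HB HC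
         |X T' T1 HX HS] H;
  try (apply PermutationA_singleton in H as (b & -> & Hb); inversion Hb; subst;
       (econstructor + eapply shape_var); eauto using gtyped_pcong; fail).
  assert (H' : PermutationA atom_eq L' M) by (symmetry; auto).
  assert (Hq : forall a, In a L' -> exists l P, a = PIn q l P).
  { intros b Hb. destruct (PermutationA_In _ _ _ H' Hb) as (a & Ha & Hab).
    destruct (HA a Ha) as (l & P & ->). inversion Hab; subst; eauto. }
  eapply shape_in; eauto.
  - intros ->. destruct M as [|a M]; [tauto|].
    destruct (PermutationA_In _ _ a H) as (b & [] & _). left; auto.
  - intros l S U HI. destruct (HB _ _ _ HI) as (P & HP).
    destruct (PermutationA_In _ _ _ H HP) as (b & Hb & E). inversion E; subst; eauto.
  - intros l S U P HI HP. destruct (PermutationA_In _ _ _ H' HP) as (b & Hb & E).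
    inversion E; subst. destruct (HC _ _ _ _ HI Hb) as (S0 & ? & ?).
    exists S0; split; auto. eapply gtyped_pcong; eauto. apply cc_sym; auto.
Qed.

Lemma ptyped_vshift_head Gamma Delta P T S :
  ptyped Gamma Delta P T -> ptyped (S :: Gamma) Delta (vshift 0 P) T.
Proof. intros H. apply (ptyped_vshift _ _ _ _ S H []); auto. Qed.

Lemma shape_psubst Gamma Delta L T T0 A :
  shape Gamma (T0 :: Delta) L T -> ~ In (PVar 0) L -> ptyped Gamma Delta A T0 -> guarded A ->
  shape Gamma Delta (map (psubst 0 A) L) T.
Proof.
  intros [T' HU|q l e P T' bs S U HU HI HE HP|e P1 P2 T' HE HP1 HP2|q M T' bs HU HL HA HB HC
         |X T' T1 HX HS] H0 HT HG; simpl.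
  - constructor; auto.
  - econstructor; eauto using gtyped_psubst.
  - econstructor; eauto using gtyped_psubst.
  - eapply shape_in; eauto.
    + apply map_nonempty; auto.
    + intros b Hb. apply in_map_iff in Hb as (a & <- & Ha).
      destruct (HA a Ha) as (l & P & ->). simpl; eauto.
    + intros l S U HI. destruct (HB _ _ _ HI) as (P & HP).
      apply (in_map (psubst 0 A)) in HP. simpl in HP; eauto.
    + intros l S U P HI HP. apply in_map_iff in HP as (a & E & Ha).
      destruct (HA a Ha) as (l' & P' & ->). simpl in E. injection E as <- <-.
      destruct (HC _ _ _ _ HI Ha) as (S0 & ? & ?). exists S0; split; auto.
      eapply gtyped_psubst; eauto using ptyped_vshift_head. apply guarded_vshift; auto.
  - destruct X as [|X]; [destruct H0; left; auto|]. eapply shape_var; eauto.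
Qed.

(** [ptyped_sub] and [ptyped_unfold], which no syntax directs, are absorbed: [shape] is closed under
    supertypes, and unfolding only permutes summands up to [atom_eq]. *)
Lemma ptyped_shape Gamma Delta P T :
  ptyped Gamma Delta P T -> Forall (twf 0) Delta -> guarded P ->
  exists L, summands P L /\ shape Gamma Delta L T.
Proof.
  induction 1 as [Gamma Delta q P bs HI HN HT IH| |Gamma Delta q l e P S T HE HP IH
                 |Gamma Delta e P1 P2 T1 T2 T HE HP1 IH1 HP2 IH2 HU|Gamma Delta P T HW HP IH
                 |Gamma Delta X T HX|Gamma Delta P T T' HP IH HW HS|Gamma Delta P Q T HP IH HU];
  intros HD HG.
  - apply input_sum_summands in HI as HL. rewrite map_map in HL.
    eexists; split; [exact HL|].
    pose proof (summands_guarded _ _ HL HG) as HGL. rewrite Forall_forall in HGL.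
    eapply shape_in; [apply unfolds_in| | | |].
    + apply (summands_nonempty _ _ HL).
    + intros a Ha. apply in_map_iff in Ha as ([[[l S] Q] T] & <- & _). eauto.
    + intros l S U H. apply in_map_iff in H as ([[[l0 S0] Q] T] & E & H).
      injection E as -> -> ->. exists Q. apply in_map_iff. exists (l, S, Q, U); auto.
    + intros l S U Q HB HQ. pose proof (HGL _ HQ) as HGQ.
      apply in_map_iff in HB as ([[[l0 S0] Q0] T0] & E & HB). injection E as -> -> ->.
      apply in_map_iff in HQ as ([[[l1 S1] Q1] T1] & E & HB1). injection E as -> ->.
      (* Labels are distinct, so the summand with label [l] belongs to the branch typed at [l]. *)
      assert (E : (l, S, Q0, U) = (l, S1, Q, T1)).
      { clear - HN HB HB1. induction bs as [|[[[l2 S2] Q2] T2] bs IH]; simpl in *; [tauto|].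
        inversion HN as [|? ? Hn HN']; subst. destruct HB as [E|HB], HB1 as [E1|HB1]; auto.
        - congruence.
        - injection E as -> -> -> ->. destruct Hn. apply in_map_iff.
          exists (l, S1, Q, T1); auto.
        - injection E1 as -> -> -> ->. destruct Hn. apply in_map_iff.
          exists (l, S, Q0, U); auto. }
      injection E as <- -> <-. exists S. split; [constructor|]. apply gtyped_intro; eauto.
  - exists [PNil]. split; constructor. apply unfolds_end.
  - eexists; split; [constructor|]. econstructor; [apply unfolds_out|left; eauto| |]; eauto.
    apply gtyped_intro; auto.
  - destruct HG. eexists; split; [constructor|].
    pose proof (ptyped_twf _ _ _ _ HP1 HD). pose proof (ptyped_twf _ _ _ _ HP2 HD).
    destruct (union_type_subtype _ _ _ HU) as [HS1 HS2]; auto.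
    constructor; auto; eapply gtyped_sub; eauto using gtyped_intro.
  (* The shape of the body assumes type [T] for the bound variable. Guardedness keeps that variable
     from being a summand, so the typed recursion can replace it throughout. *)
  - pose proof HG as [Hp HGP]. destruct IH as (L & HL & HSh); auto.
    eexists; split; [apply summands_mu_intro; eauto|].
    eapply shape_psubst; eauto using ptyped_mu. eapply summands_prefixed; eauto.
  - eexists; split; [constructor|]. eapply shape_var; eauto. apply subtype_refl.
    rewrite Forall_forall in HD. apply HD. eapply nth_error_In; eauto.
  - destruct IH as (L & HL & HSh); auto. eauto using shape_sub.
  - apply unfold_eq_pcong in HU. assert (HGP : guarded P) by (apply (guarded_pcong _ _ HU); auto).
    destruct IH as (L & HL & HSh); auto. destruct (summands_exist _ HG) as (L' & HL').
    exists L'; split; auto. eapply shape_perm; eauto. eapply summands_pcong; eauto.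
Qed.

Lemma gtyped_shape P T : gtyped [] [] P T -> exists L, summands P L /\ shape [] [] L T.
Proof.
  intros (P0 & T0 & H & HG & HS & HC).
  destruct (ptyped_shape _ _ _ _ H) as (L & HL & HSh); auto.
  assert (HGP : guarded P) by (apply (guarded_pcong _ _ HC); auto).
  destruct (summands_exist _ HGP) as (L' & HL'). exists L'; split; auto.
  eapply shape_sub; eauto. eapply shape_perm; eauto. eapply summands_pcong; eauto.
Qed.

(** * Coherent environments *)

Definition tenv := participant -> stype.

Definition ended (T : stype) : Prop := unfolds T TEnd.

Definition upd (Theta : tenv) (p : participant) (T : stype) : tenv :=
  fun r => if r =? p then T else Theta r.

Definition upd2 (Theta : tenv) p T q U : tenv := upd (upd Theta p T) q U.

Lemma upd2_fst Theta p T q U : p <> q -> upd2 Theta p T q U p = T.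
Proof.
  intros H. unfold upd2, upd. rewrite Nat.eqb_refl. destruct (Nat.eqb_spec p q); congruence.
Qed.

Lemma upd2_snd Theta p T q U : upd2 Theta p T q U q = U.
Proof. unfold upd2, upd. rewrite Nat.eqb_refl. auto. Qed.

Lemma upd2_other Theta p T q U r : r <> p -> r <> q -> upd2 Theta p T q U r = Theta r.
Proof.
  intros. unfold upd2, upd. destruct (Nat.eqb_spec r q), (Nat.eqb_spec r p); congruence.
Qed.

(** An equality of functions, so that a [coherent] fact can be rewritten along it. *)
Lemma upd2_comm Theta p T q U r T' s U' :
  p <> r -> p <> s -> q <> r -> q <> s ->
  upd2 (upd2 Theta p T q U) r T' s U' = upd2 (upd2 Theta r T' s U') p T q U.
Proof.
  intros. apply functional_extensionality. intros x. unfold upd2, upd.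
  repeat match goal with |- context [?a =? ?b] => destruct (Nat.eqb_spec a b) end; congruence.
Qed.

Lemma not_ended_in T q bs : unfolds T (TIn q bs) -> ~ ended T.
Proof. intros H HE. pose proof (unfolds_det _ _ H _ HE). discriminate. Qed.

Lemma not_ended_out T q bs : unfolds T (TOut q bs) -> ~ ended T.
Proof. intros H HE. pose proof (unfolds_det _ _ H _ HE). discriminate. Qed.

(* [coherent Theta d]: the environment [Theta] behaves like the projections of a global tree,
   in which every participant [r] that has not ended acts within [d r] further messages. *)
Definition coherent_step (R : tenv -> (participant -> nat) -> Prop)
    (Theta : tenv) (d : participant -> nat) : Prop :=
  (forall r, ended (Theta r)) \/
  exists p q bs bs',
    p <> q /\ unfolds (Theta p) (TOut q bs) /\ unfolds (Theta q) (TIn p bs') /\ bs <> [] /\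
    forall l S U, In (l, S, U) bs ->
      (exists S' U', In (l, S', U') bs') /\
      forall S' U', In (l, S', U') bs' ->
        subsort S S' /\
        exists d', R (upd2 Theta p U q U') d' /\
          forall r, r <> p -> r <> q -> ~ ended (Theta r) -> d' r < d r.

Definition coherent (Theta : tenv) (d : participant -> nat) : Prop :=
  exists R : tenv -> (participant -> nat) -> Prop,
    (forall Theta d, R Theta d -> coherent_step R Theta d) /\ R Theta d.

Lemma coherent_step_mono (R R' : tenv -> (participant -> nat) -> Prop) Theta d :
  (forall Theta d, R Theta d -> R' Theta d) -> coherent_step R Theta d -> coherent_step R' Theta d.
Proof.
  intros HR [H|(p & q & bs & bs' & Hpq & Hp & Hq & Hn & H)]; [left; auto|right].
  exists p, q, bs, bs'. repeat split; auto.
  - apply (H _ _ _ H0).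
  - apply (proj2 (H _ _ _ H0) _ _ H1).
  - destruct (proj2 (H _ _ _ H0) _ _ H1) as (_ & d' & ? & ?). eauto.
Qed.

Lemma coherent_unfold Theta d : coherent Theta d -> coherent_step coherent Theta d.
Proof.
  intros (R & HR & H). eapply coherent_step_mono; [|apply HR, H]. intros; exists R; auto.
Qed.

Lemma coherent_fold Theta d : coherent_step coherent Theta d -> coherent Theta d.
Proof.
  intros H. exists (coherent_step coherent). split; auto. clear. intros Theta d H.
  eapply coherent_step_mono; [|exact H]. apply coherent_unfold.
Qed.

(** Lets one bound serve finitely many branches whose own bounds are only known to exist. *)
Lemma finite_bound {A} (L : list A) (Q : A -> nat -> Prop) :
  (forall a n m, Q a n -> n <= m -> Q a m) ->
  (forall a, In a L -> exists n, Q a n) -> exists n, forall a, In a L -> Q a n.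
Proof.
  intros HM. induction L as [|a L IH]; intros H.
  - exists 0. intros a [].
  - destruct (H a) as [n Hn]; [left; auto|]. destruct IH as [m Hm]; [intros; apply H; right; auto|].
    exists (max n m). intros b [->|Hb]; [apply (HM _ n) | apply (HM _ m)]; auto; lia.
Qed.

(* Any matching pair may communicate: if it is not the pair at the root of the global tree, the
   communication happens in every branch below the root, at a depth bounded by [d r]. *)
Lemma coherent_comm n : forall Theta d r s bsr bss,
  d r <= n -> coherent Theta d ->
  unfolds (Theta r) (TOut s bsr) -> unfolds (Theta s) (TIn r bss) ->
  forall l S U, In (l, S, U) bsr ->
    (exists S' U', In (l, S', U') bss) /\
    forall S' U', In (l, S', U') bss ->
      subsort S S' /\
      exists d', coherent (upd2 Theta r U s U') d' /\
        forall x, x <> r -> x <> s -> ~ ended (Theta x) -> d' x <= d x.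
Proof.
  induction n as [n IH] using lt_wf_ind. intros Theta d r s bsr bss Hn HC Hr Hs l S U HI.
  pose proof (not_ended_out _ _ _ Hr) as Er. pose proof (not_ended_in _ _ _ Hs) as Es.
  destruct (coherent_unfold _ _ HC) as [H|(p & q & bs & bs' & Hpq & Hp & Hq & Hne & H)];
    [destruct (Er (H r))|].
  destruct (Nat.eq_dec p r) as [->|Npr].
  { pose proof (unfolds_det _ _ Hr _ Hp) as E. injection E as <- <-.
    pose proof (unfolds_det _ _ Hs _ Hq) as E. injection E as <-.
    destruct (H _ _ _ HI) as (H1 & H2). split; auto. intros S' U' HI'.
    destruct (H2 _ _ HI') as (HSS & d' & Hd' & Hlt). split; auto. exists d'; split; auto.
    intros x Hx1 Hx2 Hx3. specialize (Hlt x Hx1 Hx2 Hx3). lia. }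
  (* The two pairs are disjoint: head normal forms are unique, so nobody is both sender and
     receiver, and a common receiver would name a common sender. *)
  assert (Nqs : q <> s).
  { intros ->. pose proof (unfolds_det _ _ Hs _ Hq) as E. injection E as E _. congruence. }
  assert (Nqr : q <> r).
  { intros ->. pose proof (unfolds_det _ _ Hr _ Hq) as E. discriminate. }
  assert (Nps : p <> s).
  { intros ->. pose proof (unfolds_det _ _ Hs _ Hp) as E. discriminate. }
  (* Below the root [r] and [s] keep their types and the bound of [r] has decreased, so the
     induction hypothesis lets them communicate in each branch. *)
  assert (Hstep : forall l0 S0 U0 S0' U0', In (l0, S0, U0) bs -> In (l0, S0', U0') bs' ->
    (exists S' U', In (l, S', U') bss) /\
    forall S' U', In (l, S', U') bss ->
      subsort S S' /\
      exists d', coherent (upd2 (upd2 Theta r U s U') p U0 q U0') d' /\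
        forall x, x <> p -> x <> q -> x <> r -> x <> s -> ~ ended (Theta x) -> d' x < d x).
  { intros l0 S0 U0 S0' U0' HI0 HI0'. destruct (H _ _ _ HI0) as (_ & H2).
    destruct (H2 _ _ HI0') as (_ & d0 & Hd0 & Hlt).
    assert (Hdr : d0 r < d r) by auto.
    destruct (IH (d0 r) ltac:(lia) (upd2 Theta p U0 q U0') d0 r s bsr bss ltac:(lia) Hd0)
      with (l := l) (S := S) (U := U) as (H3 & H4);
      try (rewrite upd2_other by auto); auto.
    split; auto. intros S' U' HI'. destruct (H4 _ _ HI') as (HSS & d1 & Hd1 & Hle).
    split; auto. exists d1. rewrite upd2_comm in Hd1 by auto. split; auto.
    intros x Hx1 Hx2 Hx3 Hx4 Hx5. specialize (Hlt x Hx1 Hx2 Hx5).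
    specialize (Hle x Hx3 Hx4). rewrite upd2_other in Hle by auto. specialize (Hle Hx5). lia. }
  (* The label and sort conditions do not depend on the branch of the root, so any one branch proves
     them. *)
  assert (Hhead : exists l0 S0 U0 S0' U0', In (l0, S0, U0) bs /\ In (l0, S0', U0') bs').
  { destruct bs as [|[[l0 S0] U0] bs]; [congruence|].
    destruct (H l0 S0 U0) as ((S0' & U0' & ?) & _); [left; auto|].
    exists l0, S0, U0, S0', U0'. split; auto. left; auto. }
  destruct Hhead as (l0 & S0 & U0 & S0' & U0' & HI0 & HI0').
  destruct (Hstep _ _ _ _ _ HI0 HI0') as (H1 & H2). split; auto.
  intros S' U' HI'. destruct (H2 _ _ HI') as (HSS & _). split; auto. clear H1 H2 HI0 HI0'.
  (* Each branch yields its own new bounds for [r] and [s], but the root needs a single value above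
     all of them. Pairs with different labels never communicate and impose nothing. *)
  destruct (finite_bound (list_prod bs bs')
    (fun '((l1, S1, U1), (l2, S2, U2)) N =>
       l1 = l2 -> exists d', coherent (upd2 (upd2 Theta r U s U') p U1 q U2) d' /\
         d' r < N /\ d' s < N /\
         forall x, x <> p -> x <> q -> x <> r -> x <> s -> ~ ended (Theta x) -> d' x < d x))
    as [N HN].
  { intros [[[l1 S1] U1] [[l2 S2] U2]] i j Hi Hij E. destruct (Hi E) as (d' & ? & ? & ? & ?).
    exists d'. repeat split; auto; lia. }
  { intros [[[l1 S1] U1] [[l2 S2] U2]] Hin. apply in_prod_iff in Hin as [Hin1 Hin2].
    destruct (Nat.eq_dec l1 l2) as [->|NE]; [|exists 0; congruence].
    destruct (Hstep _ _ _ _ _ Hin1 Hin2) as (_ & H2).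
    destruct (H2 _ _ HI') as (_ & d' & Hd' & Hlt).
    exists (1 + d' r + d' s). intros _. exists d'. repeat split; auto; lia. }
  (* [r] and [s] have just acted and start over from [N]; everyone else keeps the old bound, so
     removing the communication delays nobody. *)
  exists (fun x => if x =? r then N else if x =? s then N else d x). split.
  - apply coherent_fold. right. exists p, q, bs, bs'.
    rewrite !upd2_other by auto. repeat split; auto.
    + apply (H _ _ _ H0).
    + apply (proj2 (H _ _ _ H0) _ _ H1).
    + pose proof (HN _ (in_prod _ _ _ _ H0 H1)) as Hd. simpl in Hd.
      destruct (Hd eq_refl) as (d' & Hd' & Hdr & Hds & Hlt). exists d'. split; auto.
      intros x Hx1 Hx2 Hx3.
      destruct (Nat.eqb_spec x r) as [->|]; auto. destruct (Nat.eqb_spec x s) as [->|]; auto.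
      rewrite upd2_other in Hx3 by auto. auto.
  - intros x Hx1 Hx2 _. destruct (Nat.eqb_spec x r), (Nat.eqb_spec x s); congruence || lia.
Qed.

(** * Projection *)

Lemma merge_twf n T1 T2 T : merge T1 T2 T -> twf n T1 -> twf n T2 -> twf n T.
Proof.
  intros [|q bs1 bs2 H1 H2 Hd] W1 W2; auto.
  destruct (twf_in_inv _ _ _ _ W1 H1) as (? & ? & ?), (twf_in_inv _ _ _ _ W2 H2) as (? & ? & ?).
  constructor.
  - destruct bs1; simpl; congruence.
  - apply NoDup_labels_app; auto.
  - intros l S U HU. apply in_app_iff in HU as [|]; eauto.
Qed.

Lemma merge_subtype T1 T2 T :
  merge T1 T2 T -> twf 0 T1 -> twf 0 T2 -> subtype T T1 /\ subtype T T2.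
Proof.
  intros [H|q bs1 bs2 H1 H2 Hd] W1 W2.
  - split; [apply subtype_refl | apply teq_subtype]; auto.
  - split; eapply subtype_in_incl; eauto; intros ? ?; apply in_app_iff; auto.
Qed.

Section MergeAll.
Variable A : stype -> Prop.
Hypothesis A_merge : forall T1 T2 T, merge T1 T2 T -> A T -> A T1 /\ A T2.

(** Used for two properties of heads that pass from a merge to its arguments: being a given
    variable, and being [active]. *)
Lemma merge_all_inherit Ts T : merge_all Ts T -> A T -> forall U, In U Ts -> A U.
Proof.
  induction 1 as [T|Ts Ts1 Ts2 T1 T2 T HP H1 IH1 H2 IH2 HM]; intros HT U HU.
  - destruct HU as [<-|[]]; auto.
  - destruct (A_merge _ _ _ HM HT). apply (Permutation_in _ HP), in_app_iff in HU as [|]; auto.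
Qed.
End MergeAll.

Lemma merge_all_twf n Ts T : merge_all Ts T -> (forall U, In U Ts -> twf n U) -> twf n T.
Proof.
  induction 1 as [T|Ts Ts1 Ts2 T1 T2 T HP H1 IH1 H2 IH2 HM]; intros HU.
  - apply HU; left; auto.
  - assert (HU' : forall U, In U (Ts1 ++ Ts2) -> twf n U)
      by (intros; apply HU, (Permutation_in _ (Permutation_sym HP)); auto).
    eapply merge_twf; eauto; [apply IH1 | apply IH2]; intros; apply HU', in_app_iff; auto.
Qed.

Lemma merge_all_subtype Ts T :
  merge_all Ts T -> (forall U, In U Ts -> twf 0 U) -> forall U, In U Ts -> subtype T U.
Proof.
  induction 1 as [T|Ts Ts1 Ts2 T1 T2 T HP H1 IH1 H2 IH2 HM]; intros HW U HU.
  - destruct HU as [<-|[]]. apply subtype_refl, HW; left; auto.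
  - assert (HW' : forall U, In U (Ts1 ++ Ts2) -> twf 0 U)
      by (intros; apply HW, (Permutation_in _ (Permutation_sym HP)); auto).
    assert (HW1 : forall U, In U Ts1 -> twf 0 U) by (intros; apply HW', in_app_iff; auto).
    assert (HW2 : forall U, In U Ts2 -> twf 0 U) by (intros; apply HW', in_app_iff; auto).
    destruct (merge_subtype _ _ _ HM); eauto using merge_all_twf.
    apply (Permutation_in _ HP), in_app_iff in HU as [|]; eauto using subtype_trans.
Qed.

(** An intersection is never headed by a variable, which leaves only the merge of equal trees. *)
Lemma merge_head_var k T1 T2 T :
  merge T1 T2 T -> ~ tprefixed k T -> ~ tprefixed k T1 /\ ~ tprefixed k T2.
Proof.
  intros [H|p bs bs' H1 H2 Hd] Hk; [|simpl in Hk; tauto]. split; auto.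
  destruct (teq_unfold _ _ H) as [H1 H2|t H1 H2|p bs bs' H1 H2|p bs bs' H1 H2];
  pose proof (unfolds_var_inv _ _ _ H1 Hk) as E; inversion E; subst.
  apply unfolds_var; auto.
Qed.

(** For open types this is stronger than not having ended, as the head may also be a variable. *)
Definition active (T : stype) : Prop :=
  exists p bs, unfolds T (TIn p bs) \/ unfolds T (TOut p bs).

Lemma merge_active T1 T2 T : merge T1 T2 T -> active T -> active T1 /\ active T2.
Proof.
  intros [H|p bs bs' H1 H2 Hd] Hk.
  - split; auto. destruct Hk as (p & bs0 & Hk).
    destruct (teq_unfold _ _ H) as [H1 H2|t H1 H2|q bs bs' H1 H2|q bs bs' H1 H2];
    destruct Hk as [Hk|Hk]; pose proof (unfolds_det _ _ H1 _ Hk) as E; inversion E; subst;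
    unfold active; eauto.
  - split; unfold active; eauto.
Qed.

(** Coinduction on substituted pairs, joined with [teq] itself: where [k] heads both types, both
    continue as [W], and the pairs reached from there are no longer substitution instances. *)
Lemma teq_tsubst k W T T' :
  twf 0 W -> teq T T' -> teq (tsubst k W T) (tsubst k W T').
Proof.
  intros HW H.
  exists (fun A B => (exists T T', teq T T' /\ A = tsubst k W T /\ B = tsubst k W T') \/ teq A B).
  split; [|left; eauto]. clear - HW.
  assert (Hb : forall (R R' : stype -> stype -> Prop) bs bs',
    (forall U U', R U U' -> R' U U') -> teq_branches R bs bs' -> teq_branches R' bs bs').
  { intros R R' bs bs' HR [H1 H2]; split; intros l S U HU;
    [destruct (H1 _ _ _ HU) as (U' & ? & ?) | destruct (H2 _ _ _ HU) as (U' & ? & ?)];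
    exists U'; auto. }
  intros A B [(T & T' & H & -> & ->)|H].
  - apply teq_unfold in H.
    assert (Hbm : forall bs bs', teq_branches teq bs bs' ->
      teq_branches (fun A B => (exists T T', teq T T' /\ A = tsubst k W T /\ B = tsubst k W T')
                               \/ teq A B)
        (map (fun '(l, s, U) => (l, s, tsubst k W U)) bs)
        (map (fun '(l, s, U) => (l, s, tsubst k W U)) bs')).
    { intros bs bs' [H1 H2]; split; intros l S U HU; apply in_branch_map in HU as (U0 & HU & ->);
      [destruct (H1 _ _ _ HU) as (U' & ? & ?) | destruct (H2 _ _ _ HU) as (U' & ? & ?)];
      exists (tsubst k W U'); rewrite in_branch_map;
      (split; [exists U'; auto | left; do 2 eexists; split; [eassumption|]; auto]). }
    destruct H as [H H'|t H H'|p bs bs' H H' HB|p bs bs' H H' HB].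
    + apply teq_step_end; change TEnd with (tsubst k W TEnd);
      apply unfolds_tsubst; auto; discriminate.
    + destruct (Nat.eq_dec t k) as [->|Ht].
      * pose proof (teq_unfold _ _ (teq_refl _ _ HW)) as HWW.
        destruct HWW as [H1 H2|t H1 H2|p bs bs' H1 H2 HB|p bs bs' H1 H2 HB];
        apply (unfolds_tsubst_var _ _ _ _ H) in H1; apply (unfolds_tsubst_var _ _ _ _ H') in H2;
        [eapply teq_step_end | eapply teq_step_var | eapply teq_step_in | eapply teq_step_out];
        try exact H1; try exact H2; (eapply Hb; [|exact HB]; auto).
      * assert (E : exists t', tsubst k W (TVar t) = TVar t').
        { simpl. index_cases; eauto. }
        destruct E as [t' E]. apply (teq_step_var _ _ _ t'); rewrite <- E;
        apply unfolds_tsubst; auto; congruence.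
    + apply (unfolds_tsubst _ _ k W) in H, H'; try discriminate.
      eapply teq_step_in; eauto.
    + apply (unfolds_tsubst _ _ k W) in H, H'; try discriminate.
      eapply teq_step_out; eauto.
  - destruct (teq_unfold _ _ H) as [H1 H2|t H1 H2|p bs bs' H1 H2 HB|p bs bs' H1 H2 HB];
    [eapply teq_step_end | eapply teq_step_var | eapply teq_step_in | eapply teq_step_out]; eauto;
    (eapply Hb; [|eassumption]; auto).
Qed.

Lemma merge_tsubst k W T1 T2 T :
  twf 0 W -> merge T1 T2 T -> merge (tsubst k W T1) (tsubst k W T2) (tsubst k W T).
Proof.
  intros HW [H|p bs bs' H1 H2 Hd].
  - constructor. apply teq_tsubst; auto.
  - apply (unfolds_tsubst _ _ k W) in H1, H2; try discriminate. simpl in *.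
    rewrite map_app. apply merge_in; auto.
    intros l Hl Hl'. rewrite labels_branch_map in *. eapply Hd; eauto.
Qed.

Lemma merge_all_tsubst k W Ts T :
  twf 0 W -> merge_all Ts T -> merge_all (map (tsubst k W) Ts) (tsubst k W T).
Proof.
  intros HW. induction 1 as [T|Ts Ts1 Ts2 T1 T2 T HP H1 IH1 H2 IH2 HM].
  - constructor.
  - eapply merge_all_node; [|exact IH1|exact IH2|apply merge_tsubst; eauto].
    rewrite <- map_app. apply Permutation_map; auto.
Qed.

Section ProjInduction.
Variables (r : participant) (Q : gtype -> stype -> Prop).

Notation branches_ok bs bs' :=
  (Forall2 (fun b b' => fst b = fst b' /\ proj r (snd b) (snd b') /\ Q (snd b) (snd b')) bs bs').

Hypothesis Hsender : forall q bs bs', branches_ok bs bs' -> Q (GMsg r q bs) (TOut q bs').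
Hypothesis Hreceiver :
  forall p bs bs', p <> r -> branches_ok bs bs' -> Q (GMsg p r bs) (TIn p bs').
Hypothesis Hother : forall p q bs Ts T, p <> r -> q <> r ->
  Forall2 (fun b U => proj r (snd b) U /\ Q (snd b) U) bs Ts ->
  merge_all Ts T -> Q (GMsg p q bs) T.
Hypothesis Hmu : forall G T, occurs r G -> proj r G T -> Q G T -> Q (GMu G) (TMu T).
Hypothesis Hmu_end : forall G, ~ occurs r G -> Q (GMu G) TEnd.
Hypothesis Hvar : forall t, Q (GVar t) (TVar t).
Hypothesis Hend : Q GEnd TEnd.

Fixpoint proj_nested_ind G T (H : proj r G T) {struct H} : Q G T.
Proof.
  destruct H as [q bs bs' H|p bs bs' Hp H|p q bs Ts T Hp Hq H HM|G T Ho H|G Ho|t|].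
  - apply Hsender. induction H as [|b b' bs bs' [H1 H2] _ IH]; constructor; auto.
  - apply Hreceiver; [exact Hp|].
    induction H as [|b b' bs bs' [H1 H2] _ IH]; constructor; auto.
  - apply (Hother p q bs Ts T Hp Hq); [|exact HM]. clear HM.
    induction H as [|b U bs Ts H1 _ IH]; constructor; auto.
  - apply Hmu; auto.
  - apply Hmu_end; exact Ho.
  - apply Hvar.
  - exact Hend.
Qed.
End ProjInduction.

Lemma Forall2_in_l {A B} (R : A -> B -> Prop) L L' a :
  Forall2 R L L' -> In a L -> exists b, In b L' /\ R a b.
Proof.
  induction 1 as [|x y L L' Hxy _ IH]; simpl; [tauto|].
  intros [->|Hin]; [eauto|]. destruct (IH Hin) as (b & ? & ?); eauto.
Qed.

Lemma Forall2_in_r {A B} (R : A -> B -> Prop) L L' b :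
  Forall2 R L L' -> In b L' -> exists a, In a L /\ R a b.
Proof.
  induction 1 as [|x y L L' Hxy _ IH]; simpl; [tauto|].
  intros [->|Hin]; [eauto|]. destruct (IH Hin) as (a & ? & ?); eauto.
Qed.

(** This makes projected recursions contractive. A variable reaches the head of a projection only
    past messages without [r], all of whose branches lead to that same variable. If it is the
    variable bound by the enclosing recursion, [occurs r G] fails and [proj_mu] does not apply. *)
Lemma proj_head_var r G T : proj r G T -> forall k, ~ tprefixed k T ->
  ~ In r (pt G) /\ forall j, gfree j G -> j = k.
Proof.
  intros H; induction H as [q bs bs' H|p bs bs' Hp H|p q bs Ts T Hp Hq H HM|G T Ho H IH|G Ho|t|]
    using proj_nested_ind; intros k Hk; simpl in Hk; try tauto.
  - assert (HU : forall l S G, In (l, S, G) bs ->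
      ~ In r (pt G) /\ forall j, gfree j G -> j = k).
    { intros l S G HG. destruct (Forall2_in_l _ _ _ _ H HG) as (U & HU & _ & HQ). apply HQ.
      apply (merge_all_inherit _ (merge_head_var k) _ _ HM Hk _ HU). }
    split.
    + simpl. intros [|[|Hr]]; auto. apply in_flat_map in Hr as ([[l S] G] & HG & Hr).
      apply (HU _ _ _ HG); auto.
    + intros j Hj; inversion Hj; subst. eapply HU; eauto.
  - destruct (IH _ Hk) as [H1 H2]. split; auto. intros j Hj; inversion Hj; subst.
    match goal with Hf : gfree (S j) G |- _ => apply H2 in Hf; lia end.
  - split; auto. intros j Hj; inversion Hj; lia.
Qed.

Lemma Forall2_labels {A B} (R : A -> B -> Prop)
  (bs : list (label * sort * A)) (bs' : list (label * sort * B)) :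
  Forall2 (fun b b' => fst b = fst b' /\ R (snd b) (snd b')) bs bs' -> labels bs' = labels bs.
Proof.
  unfold labels. induction 1 as [|b b' bs bs' [E _] _ IH]; simpl; [auto|]. rewrite E, IH; auto.
Qed.

Lemma Forall2_branch_r {A B} (R : A -> B -> Prop)
  (bs : list (label * sort * A)) (bs' : list (label * sort * B)) l S U :
  Forall2 (fun b b' => fst b = fst b' /\ R (snd b) (snd b')) bs bs' -> In (l, S, U) bs' ->
  exists G, In (l, S, G) bs /\ R G U.
Proof.
  intros H HI. destruct (Forall2_in_r _ _ _ _ H HI) as ([[l0 S0] G] & HG & E & HR).
  simpl in *. injection E as -> ->. eauto.
Qed.

Lemma Forall2_branch_l {A B} (R : A -> B -> Prop)
  (bs : list (label * sort * A)) (bs' : list (label * sort * B)) l S G :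
  Forall2 (fun b b' => fst b = fst b' /\ R (snd b) (snd b')) bs bs' -> In (l, S, G) bs ->
  exists U, In (l, S, U) bs' /\ R G U.
Proof.
  intros H HI. destruct (Forall2_in_l _ _ _ _ H HI) as ([[l0 S0] U] & HG & E & HR).
  simpl in *. injection E as <- <-. eauto.
Qed.

Lemma Forall2_nonempty {A B} (R : A -> B -> Prop) L L' : Forall2 R L L' -> L <> [] -> L' <> [].
Proof. intros H Hn. inversion H; congruence. Qed.

Lemma gfree_bound j G : gfree j G -> forall n, gwf n G -> j < n.
Proof.
  induction 1; intros n Hn; inversion Hn; subst; eauto.
  match goal with H : gwf (S n) _ |- _ => apply IHgfree in H; lia end.
Qed.

Lemma proj_twf r G T : proj r G T -> forall n, gwf n G -> twf n T.
Proof.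
  intros H; induction H as [q bs bs' H|p bs bs' Hp H|p q bs Ts T Hp Hq H HM|G T Ho H IH|G Ho|t|]
    using proj_nested_ind; intros n Hn; inversion Hn; subst.
  - constructor; [eauto using Forall2_nonempty| |].
    + rewrite (Forall2_labels (fun G T => proj r G T /\ forall n, gwf n G -> twf n T) _ _ H); auto.
    + intros l S U HU.
      destruct (Forall2_branch_r (fun G T => proj r G T /\ forall n, gwf n G -> twf n T)
        _ _ _ _ _ H HU) as (G & HG & _ & IH).
      eauto.
  - constructor; [eauto using Forall2_nonempty| |].
    + rewrite (Forall2_labels (fun G T => proj r G T /\ forall n, gwf n G -> twf n T) _ _ H); auto.
    + intros l S U HU.
      destruct (Forall2_branch_r (fun G T => proj r G T /\ forall n, gwf n G -> twf n T)
        _ _ _ _ _ H HU) as (G & HG & _ & IH).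
      eauto.
  - eapply merge_all_twf; eauto. intros U HU.
    destruct (Forall2_in_r _ _ _ _ H HU) as ([[l S] G] & HG & _ & IH). eauto.
  - constructor; auto. destruct (tprefixed_dec 0 T) as [|H0]; auto.
    destruct (proj_head_var _ _ _ H _ H0) as [Hr Hf].
    destruct Ho as [|[k Hk]]; [tauto|]. apply Hf in Hk. lia.
  - constructor.
  - constructor; auto.
  - constructor.
Qed.

(** * Unfolding of global types *)

(* Only used for closed [V] and the outermost free variable [k], so nothing is shifted. *)
Fixpoint gsubst (k : nat) (V : gtype) (G : gtype) : gtype :=
  match G with
  | GMsg p q bs => GMsg p q (map (fun '(l, s, H) => (l, s, gsubst k V H)) bs)
  | GMu G => GMu (gsubst (S k) V G)
  | GVar t => if t =? k then V else GVar t
  | GEnd => GEnd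
  end.

Lemma gtype_nested_ind (P : gtype -> Prop) :
  (forall p q bs, (forall l S G, In (l, S, G) bs -> P G) -> P (GMsg p q bs)) ->
  (forall G, P G -> P (GMu G)) -> (forall t, P (GVar t)) -> P GEnd ->
  forall G, P G.
Proof.
  intros Hmsg Hmu Hvar Hend. fix IH 1. intros [p q bs|G|t|];
  [apply Hmsg | apply Hmu, IH | apply Hvar | apply Hend].
  induction bs as [|[[l' S'] G'] bs IHbs]; intros l S G; [intros [] |].
  intros [E|H]; [injection E as <- <- <-; apply IH | apply (IHbs l S G H)].
Qed.

Lemma gsubst_nofree V G : forall k, ~ gfree k G -> gsubst k V G = G.
Proof.
  induction G as [p q bs IH|G IH|t|] using gtype_nested_ind; simpl; intros k Hk.
  - f_equal. rewrite <- map_id. apply map_ext_in. intros [[l S] G] HG. f_equal.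
    eapply IH; eauto. intros Hf; apply Hk; econstructor; eauto.
  - f_equal. apply IH. intros Hf; apply Hk; constructor; auto.
  - destruct (Nat.eqb_spec t k); auto. subst. destruct Hk; constructor.
  - auto.
Qed.

Lemma pt_gsubst_incl r V G : forall k, In r (pt G) -> In r (pt (gsubst k V G)).
Proof.
  induction G as [p q bs IH|G IH|t|] using gtype_nested_ind; simpl; intros k Hk; auto; try tauto.
  destruct Hk as [|[|Hk]]; auto. do 2 right.
  apply in_flat_map in Hk as ([[l S] G] & HG & Hr). apply in_flat_map.
  exists (l, S, gsubst k V G). split; [apply in_branch_map|]; eauto.
Qed.

Lemma pt_gsubst_free r V k G : gfree k G -> In r (pt V) -> In r (pt (gsubst k V G)).
Proof.
  intros H Hr; induction H; simpl; auto.
  - do 2 right. apply in_flat_map. exists (l, S, gsubst k V G).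
    split; [apply in_branch_map; exists G; auto|]; auto.
  - rewrite Nat.eqb_refl. auto.
Qed.

Lemma pt_gsubst_inv r V G : forall k,
  In r (pt (gsubst k V G)) -> In r (pt G) \/ In r (pt V).
Proof.
  induction G as [p q bs IH|G IH|t|] using gtype_nested_ind; simpl; intros k Hk; eauto.
  - destruct Hk as [|[|Hk]]; auto. apply in_flat_map in Hk as ([[l S] G] & HG & Hr).
    apply in_branch_map in HG as (G0 & HG & ->). destruct (IH _ _ _ HG _ Hr); auto.
    left. do 2 right. apply in_flat_map. exists (l, S, G0); auto.
  - destruct (Nat.eqb_spec t k); auto.
Qed.

Lemma gfree_gsubst j V G : gfree j G -> forall k, j <> k -> gfree j (gsubst k V G).
Proof.
  induction 1; intros k' Hk; simpl.
  - eapply gfree_msg; [apply in_branch_map; eauto|]; auto.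
  - constructor. auto.
  - destruct (Nat.eqb_spec k k'); [congruence|]. constructor.
Qed.

Lemma gprefixed_closed n G : gwf n G -> forall j, n <= j -> gprefixed j G.
Proof. induction 1; simpl; intros j Hj; auto; try lia. apply IHgwf; lia. Qed.

Lemma gprefixed_gsubst V G : forall j k,
  (forall i, gprefixed i V) -> gprefixed j G -> gprefixed j (gsubst k V G).
Proof. induction G; simpl; intros; auto. destruct (t =? k); auto. Qed.

Lemma gwf_weaken n G : gwf n G -> forall m, n <= m -> gwf m G.
Proof.
  induction 1; intros m Hm; constructor; eauto; try lia. apply IHgwf; lia.
Qed.

Lemma gwf_gsubst V m G : gwf 0 V -> gwf m G -> forall k, m = S k -> gwf k (gsubst k V G).
Proof.
  intros HV. induction 1 as [m p q bs Hpq Hn HN H IH|m G Hp H IH|m t Ht|m];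
  intros k ->; simpl.
  - constructor; auto.
    + apply map_nonempty; auto.
    + rewrite labels_branch_map; auto.
    + intros l S G HG. apply in_branch_map in HG as (G0 & HG & ->). eauto.
  - constructor; auto. apply gprefixed_gsubst; auto.
    intros; eapply gprefixed_closed; eauto; lia.
  - destruct (Nat.eqb_spec t k); [eapply gwf_weaken; eauto|constructor]; lia.
  - constructor.
Qed.

(* The participant test keeps the recursions that contain [k] projected as recursions. *)
Lemma proj_gsubst r V W G T :
  gwf 0 V -> proj r V W -> In r (pt V) -> proj r G T ->
  forall k, gwf (S k) G -> proj r (gsubst k V G) (tsubst k W T).
Proof.
  intros HV HP Hr H. pose proof (proj_twf _ _ _ HP _ HV) as HW.
  assert (Hb : forall k bs bs',
    Forall2 (fun b b' => fst b = fst b' /\ proj r (snd b) (snd b') /\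
      (forall k, gwf (S k) (snd b) -> proj r (gsubst k V (snd b)) (tsubst k W (snd b')))) bs bs' ->
    (forall (l : label) (S0 : sort) G, In (l, S0, G) bs -> gwf (S k) G) ->
    Forall2 (fun b b' => fst b = fst b' /\ proj r (snd b) (snd b'))
      (map (fun '(l, s, H) => (l, s, gsubst k V H)) bs)
      (map (fun '(l, s, U) => (l, s, tsubst k W U)) bs')).
  { intros k bs bs' HF Hwf. induction HF as [|[[l S1] G1] [[l' S2] T2] bs bs' (E & _ & HQ) _ IH];
    simpl in *; constructor; simpl; eauto. }
  assert (Hb' : forall k bs Ts,
    Forall2 (fun b U => proj r (snd b) U /\
      (forall k, gwf (S k) (snd b) -> proj r (gsubst k V (snd b)) (tsubst k W U))) bs Ts ->
    (forall (l : label) (S0 : sort) G, In (l, S0, G) bs -> gwf (S k) G) ->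
    Forall2 (fun b U => proj r (snd b) U)
      (map (fun '(l, s, H) => (l, s, gsubst k V H)) bs) (map (tsubst k W) Ts)).
  { intros k bs Ts HF Hwf. induction HF as [|[[l S1] G1] T2 bs Ts (_ & HQ) _ IH];
    simpl in *; constructor; simpl; eauto. }
  induction H as [q bs bs' H|p bs bs' Hp H|p q bs Ts T Hp Hq H HM|G T Ho H IH|G Ho|t|]
    using proj_nested_ind; intros k Hn; inversion Hn; subst; simpl.
  - constructor. eauto.
  - constructor; eauto.
  - eapply proj_other; [auto|auto| |apply merge_all_tsubst; eauto].
    eauto.
  (* [W] is closed, so the shift that [tsubst] performs under [TMu] does nothing, in step with
     [gsubst]. *)
  - rewrite (tshift_closed 0) by (auto; lia). constructor; auto.
    destruct Ho as [Ho|[j Hj]]; [left; apply pt_gsubst_incl; auto|].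
    destruct (Nat.eq_dec (S j) (S k)) as [E|E].
    + left. rewrite E in Hj. apply pt_gsubst_free; auto.
    + right. exists j. apply gfree_gsubst; auto.
  (* As [r] does not occur, the body has no free variable but its own, and the substitution does not
     reach it. *)
  - rewrite gsubst_nofree; [constructor; auto|]. intros Hf. apply Ho. right; eauto.
  - index_cases; constructor.
  - constructor.
Qed.

(** On every path at most [n] messages precede the first one that involves [r]. There is no rule for
    variables, so [r] acts before a recursion is entered again; hence unfolding does not change the
    bound. *)
Inductive reach (r : participant) : gtype -> nat -> Prop :=
| reach_sender q bs n : reach r (GMsg r q bs) n
| reach_receiver p bs n : reach r (GMsg p r bs) n
| reach_later p q bs n :
    (forall l S G, In (l, S, G) bs -> reach r G n) -> reach r (GMsg p q bs) (S n)
| reach_mu G n : reach r G n -> reach r (GMu G) n.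

Lemma reach_mono r G n : reach r G n -> forall m, n <= m -> reach r G m.
Proof.
  induction 1; intros m Hm; try (constructor; auto; fail).
  destruct m; [lia|]. constructor. intros; eapply H0; eauto; lia.
Qed.

Lemma reach_gsubst r V G n : reach r G n -> forall k, reach r (gsubst k V G) n.
Proof.
  induction 1; intros k; simpl; constructor; auto.
  intros l S G HG. apply in_branch_map in HG as (G0 & HG & ->). eauto.
Qed.

(** By contractiveness the head of the body is not the bound variable, and any other head is a
    communication exactly when the head of the recursion is. *)
Lemma active_mu n T : twf n (TMu T) -> active (TMu T) -> active T.
Proof.
  intros HW (p & bs & H). inversion HW as [| |? ? Hp HT| |]; subst.
  destruct (unfolds_exist _ _ HT) as [U HU].
  assert (H0 : U <> TVar 0) by (intros ->; apply unfolds_var in HU; tauto).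
  pose proof (unfolds_mu _ _ (unfolds_tsubst _ _ 0 (TMu T) HU H0)) as HU'.
  destruct U as [q bs0|q bs0|U|t|]; try (unfold active; eauto; fail).
  - destruct (unfolds_not_mu _ _ HU U); auto.
  - destruct t as [|t]; [tauto|]. simpl in HU'.
    destruct H as [H|H]; pose proof (unfolds_det _ _ HU' _ H); discriminate.
  - destruct H as [H|H]; pose proof (unfolds_det _ _ HU' _ H); discriminate.
Qed.

(** A merge succeeds only on equal trees or on two inputs, so an active merge has only active
    arguments: [r] acts in every branch, and the finitely many bounds have a maximum. A recursion
    adds nothing to the bound of its body. *)
Lemma proj_reach r G T : proj r G T -> forall n, gwf n G -> active T -> exists m, reach r G m.
Proof.
  intros H; induction H as [q bs bs' H|p bs bs' Hp H|p q bs Ts T Hp Hq H HM|G T Ho H IH|G Ho|t|]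
    using proj_nested_ind; intros n Hn HA.
  - exists 0; constructor.
  - exists 0; constructor.
  - inversion Hn; subst.
    destruct (finite_bound bs (fun b m => reach r (snd b) m)) as [m Hm].
    + intros; eapply reach_mono; eauto.
    + intros [[l S] G] HG. destruct (Forall2_in_l _ _ _ _ H HG) as (U & HU & _ & HQ).
      eapply HQ; eauto. apply (merge_all_inherit _ merge_active _ _ HM HA _ HU).
    + exists (S m). constructor. intros l S0 G HG. apply (Hm _ HG).
  - pose proof (proj_twf _ _ _ (proj_mu _ _ _ Ho H) _ Hn) as HW. inversion Hn; subst.
    destruct (IH (S n)) as [m Hm]; eauto using active_mu. exists m; constructor; auto.
  - destruct HA as (p & bs & [HA|HA]); inversion HA.
  - destruct HA as (p & bs & [HA|HA]); inversion HA.
  - destruct HA as (p & bs & [HA|HA]); inversion HA.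
Qed.

(** The bound stands outside the implication because a number must be picked even for an ended
    participant, for which it is arbitrary. *)
Lemma subtype_reach r G T U :
  gwf 0 G -> proj r G T -> twf 0 U -> subtype U T -> exists n, ~ ended U -> reach r G n.
Proof.
  intros HG HP HU HS.
  assert (HA : ended U \/ active T).
  { destruct (subtype_unfold _ _ HS); unfold active; eauto 6. }
  destruct HA as [HA|HA]; [exists 0; tauto|].
  destruct (proj_reach _ _ _ HP _ HG HA) as [m Hm]. eauto.
Qed.

(** Ties an environment to a global type, as the candidate for coinduction. A participant outside
    [G] is only asked to have ended: its projection would have to be rebuilt at each unfolding and
    each branch, and session typing supplies none for names without a component. *)
Definition projects (G : gtype) (Theta : tenv) (d : participant -> nat) : Prop :=
  gwf 0 G /\
  forall r,
    twf 0 (Theta r) /\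
    ((~ In r (pt G) /\ ended (Theta r)) \/ exists T, proj r G T /\ subtype (Theta r) T) /\
    (~ ended (Theta r) -> reach r G (d r)).

Lemma subtype_mu_r T U : subtype U (TMu T) -> subtype U (tsubst 0 (TMu T) T).
Proof.
  intros H. apply subtype_fold.
  destruct (subtype_unfold _ _ H) as [H1 H2|p bs bs' H1 H2 H3|p bs bs' H1 H2 H3];
  inversion H2; subst;
  [eapply subtype_step_end | eapply subtype_step_in | eapply subtype_step_out]; eauto; exfalso;
  match goal with H : forall U, _ <> _ |- _ => eapply H; eauto end.
Qed.

Lemma projects_unfold G Theta d :
  projects (GMu G) Theta d -> projects (gsubst 0 (GMu G) G) Theta d.
Proof.
  intros [HG H]. assert (HG1 : gwf 1 G) by (inversion HG; auto).
  split; [eapply gwf_gsubst; eauto|].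
  intros r. destruct (H r) as (HW & HP & HR). split; [auto|split].
  - assert (Hn : ~ In r (pt G) -> ~ In r (pt (gsubst 0 (GMu G) G))).
    { intros Hn Hr. apply pt_gsubst_inv in Hr as [|]; auto. }
    destruct HP as [[Hr HE]|(T & HP & HS)]; [left; auto|].
    inversion HP as [| | |G0 T1 Ho HP1|G0 Ho| |]; subst.
    + right. exists (tsubst 0 (TMu T1) T1). split; [|apply subtype_mu_r; auto].
      apply proj_gsubst; auto. destruct Ho as [|[k Hk]]; auto.
      apply (gfree_bound _ _ Hk) in HG1. lia.
    + left. split; [apply Hn; intros Hr; apply Ho; left; auto|].
      eapply subtype_end_inv; eauto. apply unfolds_end.
  - intros HE. specialize (HR HE). inversion HR; subst. apply reach_gsubst; auto.
Qed.

(** Termination measure for unfolding down to a message or [GEnd]: contractiveness keeps the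
    substitution from adding recursions at the head. *)
Fixpoint gheight (G : gtype) : nat := match G with GMu G => S (gheight G) | _ => 0 end.

Lemma gheight_gsubst V G : forall k, gprefixed k G -> gheight (gsubst k V G) = gheight G.
Proof.
  induction G; simpl; intros k Hk; auto. destruct (Nat.eqb_spec t k); [contradiction | auto].
Qed.

Lemma projects_head n : forall G Theta d, gheight G <= n -> projects G Theta d ->
  exists G', projects G' Theta d /\ (G' = GEnd \/ exists p q bs, G' = GMsg p q bs).
Proof.
  induction n as [|n IH]; intros G Theta d Hn H; destruct G as [p q bs|G|t|]; simpl in Hn;
  try (eexists; split; [exact H|]; eauto; fail);
  try (destruct H as [H _]; inversion H; lia); try lia.
  pose proof (projects_unfold _ _ _ H) as H'. apply IH in H'; auto.
  destruct H as [H _]; inversion H; subst. rewrite gheight_gsubst; auto; lia.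
Qed.

Lemma projects_coherent G Theta d : projects G Theta d -> coherent Theta d.
Proof.
  intros H. exists (fun Theta d => exists G, projects G Theta d). split; [|eauto].
  clear. intros Theta d [G0 H0].
  destruct (projects_head _ _ _ _ (le_n _) H0) as (G & [HG H] & [->|(p & q & bs & ->)]);
    clear G0 H0.
  - left. intros r. destruct (H r) as (_ & [[_ HE]|(T & HP & HS)] & _); auto.
    inversion HP; subst. eapply subtype_end_inv; eauto. apply unfolds_end.
  - inversion HG as [? ? ? ? Hpq Hne HN Hbs| | |]; subst. right.
    destruct (H p) as (HWp & HPp & _). destruct (H q) as (HWq & HPq & _).
    destruct HPp as [[Hp _]|(T & HPp & HSp)]; [destruct Hp; simpl; auto|].
    destruct HPq as [[Hq _]|(T' & HPq & HSq)]; [destruct Hq; simpl; auto|].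
    inversion HPp as [? ? bs1 HF1| | | | | |]; subst; try congruence.
    inversion HPq as [|? ? bs2 _ HF2| | | | |]; subst; try congruence.
    destruct (subtype_out_inv _ _ _ _ HSp (unfolds_out _ _)) as (bsp & HUp & HBp).
    destruct (subtype_in_inv _ _ _ _ HSq (unfolds_in _ _)) as (bsq & HUq & HBq).
    destruct (twf_out_inv _ _ _ _ HWp HUp) as (Hnep & _ & HWp').
    destruct (twf_in_inv _ _ _ _ HWq HUq) as (_ & HNq & HWq').
    exists p, q, bsp, bsq. do 4 (split; auto). intros l S U HI.
    (* A label sent by [p] is followed through the projection on [p], the branch of the global type
       and the projection on [q], to an input that [q] offers. Subtyping lets [p] omit labels and
       [q] add some. *)
    destruct (HBp _ _ _ HI) as (S1 & U1 & HI1 & HS1 & HU1).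
    destruct (Forall2_branch_r _ _ _ _ _ _ HF1 HI1) as (G1 & HG1 & HP1).
    destruct (Forall2_branch_l _ _ _ _ _ _ HF2 HG1) as (U2 & HI2 & HP2).
    destruct (HBq _ _ _ HI2) as (S3 & U3 & HI3 & HS3 & HU3).
    split; [eauto|]. intros S' U' HI'.
    (* Labels are distinct, so the input of [q] under [l] is the one just found. *)
    destruct (NoDup_labels_unique _ _ _ _ _ _ HNq HI3 HI') as [<- <-].
    split; [eauto using subsort_trans|].
    pose proof (Hbs _ _ _ HG1) as HWG1.
    destruct (subtype_reach _ _ _ _ HWG1 HP1 (HWp' _ _ _ HI) HU1) as [n1 Hn1].
    destruct (subtype_reach _ _ _ _ HWG1 HP2 (HWq' _ _ _ HI3) HU3) as [n2 Hn2].
    (* The root message does not involve [r], so its bound already counts this message and is a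
       successor. *)
    assert (Hlater : forall r, r <> p -> r <> q -> ~ ended (Theta r) ->
      pred (d r) < d r /\ reach r G1 (pred (d r))).
    { intros r Hrp Hrq HE. destruct (H r) as (_ & _ & HR). specialize (HR HE).
      inversion HR; subst; try congruence. simpl. eauto. }
    exists (fun r => if r =? p then n1 else if r =? q then n2 else pred (d r)). split.
    + exists G1. split; auto. intros r.
      destruct (Nat.eqb_spec r p) as [->|Hrp]; [|destruct (Nat.eqb_spec r q) as [->|Hrq]].
      * rewrite upd2_fst by auto. eauto 8.
      * rewrite upd2_snd. eauto 8.
      * rewrite upd2_other by auto. destruct (H r) as (HWr & HPr & _).
        split; [auto|split; [|intros HE; apply Hlater; auto]].
        destruct HPr as [[Hr HE]|(Tr & HPr & HSr)].
        { left. split; auto. intros Hr1. apply Hr. simpl. do 2 right.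
          apply in_flat_map. exists (l, S1, G1); auto. }
        (* Passing to one branch replaces the merge by one of its arguments, which is a supertype of
           it. *)
        { right. inversion HPr as [| |? ? ? Ts ? _ _ HF HM| | | |]; subst; try congruence.
          destruct (Forall2_in_l _ _ _ _ HF HG1) as (Ti & HTi & HPi). exists Ti. split; auto.
          eapply subtype_trans; eauto. eapply merge_all_subtype; eauto.
          intros V HV. destruct (Forall2_in_r _ _ _ _ HF HV) as ([[l' S'] G'] & HG' & HP').
          eapply proj_twf; eauto. }
    + intros r Hrp Hrq HE.
      destruct (Nat.eqb_spec r p), (Nat.eqb_spec r q); try congruence. apply Hlater; auto.
Qed.

(** * Sessions *)

(** Congruence creates and erases inert components of any name, even one already present, so
    [session_typed_nil] lists no participant for them. *)
Inductive session_typed (Theta : tenv) : list participant -> session -> Prop :=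
| session_typed_role p P :
    gtyped [] [] P (Theta p) -> session_typed Theta [p] (Role p P)
| session_typed_nil p P : pcong P PNil -> session_typed Theta [] (Role p P)
| session_typed_par D D' M N :
    session_typed Theta D M -> session_typed Theta D' N ->
    session_typed Theta (D ++ D') (Par M N).

(** A component typed at an ended type may be erased by [sc_nil], so the list is allowed to lose
    such participants and no others. *)
Definition shrinks (Theta : tenv) (D D' : list participant) : Prop :=
  NoDup D' /\ incl D' D /\ forall p, In p D -> ended (Theta p) \/ In p D'.

Lemma shrinks_refl Theta D : NoDup D -> shrinks Theta D D.
Proof. unfold shrinks; auto using incl_refl. Qed.

Lemma shrinks_trans Theta D1 D2 D3 :
  shrinks Theta D1 D2 -> shrinks Theta D2 D3 -> shrinks Theta D1 D3.
Proof.
  intros (N2 & I2 & H2) (N3 & I3 & H3). split; [|split]; auto.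
  - eapply incl_tran; eauto.
  - intros p Hp. destruct (H2 p Hp); auto.
Qed.

Lemma shrinks_permutation Theta D D' : Permutation D D' -> NoDup D -> shrinks Theta D D'.
Proof.
  intros H HN. split; [|split].
  - eapply Permutation_NoDup; eauto.
  - intros x Hx. eapply Permutation_in; [apply Permutation_sym|]; eauto.
  - intros x Hx. right. eapply Permutation_in; eauto.
Qed.

Lemma NoDup_app_inv {A} (L L' : list A) :
  NoDup (L ++ L') -> NoDup L /\ NoDup L' /\ forall x, In x L -> ~ In x L'.
Proof.
  induction L as [|a L IH]; simpl; intros H; [repeat split; auto; constructor|].
  inversion H as [|? ? Hn HN]; subst. destruct (IH HN) as (H1 & H2 & H3).
  rewrite in_app_iff in Hn. repeat split; auto.
  - constructor; auto.
  - intros x [<-|Hx]; auto.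
Qed.

Lemma shrinks_app Theta D1 D2 D1' D2' :
  NoDup (D1 ++ D2) -> shrinks Theta D1 D1' -> shrinks Theta D2 D2' ->
  shrinks Theta (D1 ++ D2) (D1' ++ D2').
Proof.
  intros HN (N1 & I1 & H1) (N2 & I2 & H2). destruct (NoDup_app_inv _ _ HN) as (_ & _ & Hd).
  split; [|split].
  - apply NoDup_app; auto. intros x Hx Hx'. apply (Hd x); auto.
  - apply incl_app_app; auto.
  - intros p Hp. rewrite in_app_iff in *. destruct Hp as [Hp|Hp];
    [destruct (H1 p Hp) | destruct (H2 p Hp)]; auto.
Qed.

Lemma gtyped_nil_ended T : gtyped [] [] PNil T -> ended T.
Proof.
  intros H. destruct (gtyped_shape _ _ H) as (L & HL & HS). inversion HL; subst.
  inversion HS as [| | |? ? ? ? ? ? Ha|]; subst; auto.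
  destruct (Ha _ (or_introl eq_refl)) as (? & ? & E). discriminate.
Qed.

(** [sc_sym] forces both directions into one induction. In [sc_nil], erasing a component can drop
    only a participant whose type has ended, and adding one lists nobody. *)
Lemma scong_session_typed M N : scong M N -> forall Theta,
  (forall D, session_typed Theta D M -> NoDup D ->
     exists D', session_typed Theta D' N /\ shrinks Theta D D') /\
  (forall D, session_typed Theta D N -> NoDup D ->
     exists D', session_typed Theta D' M /\ shrinks Theta D D').
Proof.
  assert (Hid : forall Theta D M, session_typed Theta D M -> NoDup D ->
     exists D', session_typed Theta D' M /\ shrinks Theta D D')
    by (intros; eexists; split; eauto using shrinks_refl).
  assert (Hpar : forall Theta M M' N N',
    (forall D, session_typed Theta D M -> NoDup D ->
       exists D', session_typed Theta D' M' /\ shrinks Theta D D') ->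
    (forall D, session_typed Theta D N -> NoDup D ->
       exists D', session_typed Theta D' N' /\ shrinks Theta D D') ->
    forall D, session_typed Theta D (Par M N) -> NoDup D ->
       exists D', session_typed Theta D' (Par M' N') /\ shrinks Theta D D').
  { intros Theta M0 M1 N0 N1 H1 H2 D HD HN. inversion HD as [| |? ? ? ? HM HN']; subst.
    destruct (NoDup_app_inv _ _ HN) as (HN1 & HN2 & _).
    destruct (H1 _ HM HN1) as (D1 & ? & ?), (H2 _ HN' HN2) as (D2 & ? & ?).
    exists (D1 ++ D2). split; [constructor; auto | apply shrinks_app; auto]. }
  assert (Hproc : forall Theta p P Q D, pcong P Q -> session_typed Theta D (Role p P) ->
    session_typed Theta D (Role p Q)).
  { intros Theta p P Q D HC H. inversion H; subst; constructor.
    - eapply gtyped_pcong; eauto.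
    - eapply cc_trans; [apply cc_sym|]; eauto. }
  assert (Hcomm : forall Theta M N D, session_typed Theta D (Par M N) -> NoDup D ->
     exists D', session_typed Theta D' (Par N M) /\ shrinks Theta D D').
  { intros Theta M0 N0 D HD HN. inversion HD; subst. eexists; split; [constructor; eauto|].
    apply shrinks_permutation; auto. apply Permutation_app_comm. }
  induction 1 as [M|M N H IH|M N M' H1 IH1 H2 IH2|M M' N N' H1 IH1 H2 IH2|p P Q HC|p M|M N|M N M'];
  intros Theta.
  - split; auto.
  - destruct (IH Theta); auto.
  - destruct (IH1 Theta) as [A1 B1], (IH2 Theta) as [A2 B2]. split; intros D HD HN.
    + destruct (A1 D HD HN) as (D1 & HD1 & HS1). destruct (A2 D1 HD1) as (D2 & HD2 & HS2).
      { apply HS1. } exists D2. eauto using shrinks_trans.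
    + destruct (B2 D HD HN) as (D1 & HD1 & HS1). destruct (B1 D1 HD1) as (D2 & HD2 & HS2).
      { apply HS1. } exists D2. eauto using shrinks_trans.
  - destruct (IH1 Theta) as [A1 B1], (IH2 Theta) as [A2 B2]. split; eapply Hpar; eauto.
  - split; intros D HD HN; exists D; split; eauto using shrinks_refl.
    eapply Hproc; [apply cc_sym; exact HC|]; auto.
  - split; intros D HD HN.
    + inversion HD as [| |D1 D2 ? ? H1 H2]; subst. destruct (NoDup_app_inv _ _ HN) as (_ & HN2 & _).
      exists D2. split; auto. split; [|split]; auto.
      * apply incl_appr, incl_refl.
      * intros q Hq. apply in_app_iff in Hq as [Hq|]; auto.
        inversion H1; subst; [|destruct Hq]. destruct Hq as [<-|[]].
        left. apply gtyped_nil_ended; auto.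
    + exists ([] ++ D). split; [|apply shrinks_refl; auto]. constructor; auto.
      apply session_typed_nil, cc_refl.
  - split; auto.
  - split; intros D HD HN.
    + inversion HD as [| |D1 D2 ? ? H1 H2]; subst; inversion H1; subst.
      eexists; split; [constructor; [|constructor]; eauto|].
      rewrite <- app_assoc in *. apply shrinks_refl; auto.
    + inversion HD as [| |D1 D2 ? ? H1 H2]; subst; inversion H2; subst.
      eexists; split; [constructor; [constructor|]; eauto|].
      rewrite app_assoc in *. apply shrinks_refl; auto.
Qed.

(** Excludes [session_typed_nil] for components that take part in a redex. *)
Lemma nil_summands P L : pcong P PNil -> summands P L -> L = [PNil].
Proof.
  intros HC HL. apply cc_sym in HC.
  pose proof (summands_pcong _ _ HC I _ _ summands_nil HL) as H.
  apply PermutationA_singleton in H as (b & -> & Hb). inversion Hb; auto.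
Qed.

Lemma session_typed_agree Theta Theta' D M :
  session_typed Theta D M -> (forall r, In r D -> Theta' r = Theta r) ->
  session_typed Theta' D M.
Proof.
  induction 1; intros Ha; constructor; auto.
  - rewrite Ha; [auto|left; auto].
  - apply IHsession_typed1. intros; apply Ha, in_app_iff; auto.
  - apply IHsession_typed2. intros; apply Ha, in_app_iff; auto.
Qed.

(** * Preservation under reduction *)

Lemma gtyped_in_inv P L T q l Q :
  gtyped [] [] P T -> summands P L -> In (PIn q l Q) L ->
  exists bs, unfolds T (TIn q bs) /\
    forall S U, In (l, S, U) bs -> exists S0, subsort S S0 /\ gtyped [S0] [] Q U.
Proof.
  intros H HL HI. destruct (gtyped_shape _ _ H) as (L' & HL' & HS).
  rewrite <- (summands_det _ _ HL _ HL') in HS. clear L' HL'.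
  destruct HS as [| | |q' L T bs HU HN Ha _ HC|]; try (destruct HI as [E|[]]; discriminate E).
  destruct (Ha _ HI) as (l' & Q' & E). injection E as <- <- <-. eauto.
Qed.

Lemma gtyped_out_inv q l e P T :
  gtyped [] [] (POut q l e P) T ->
  exists bs S U, unfolds T (TOut q bs) /\ In (l, S, U) bs /\ etyped [] e S /\ gtyped [] [] P U.
Proof.
  intros H. destruct (gtyped_shape _ _ H) as (L' & HL' & HS). inversion HL'; subst.
  inversion HS as [|? ? ? ? ? bs S U| |? ? ? ? ? ? Ha|]; subst; [eauto 8|].
  destruct (Ha _ (or_introl eq_refl)) as (? & ? & E). discriminate E.
Qed.

Lemma gtyped_if_inv e P1 P2 T :
  gtyped [] [] (PIf e P1 P2) T -> gtyped [] [] P1 T /\ gtyped [] [] P2 T.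
Proof.
  intros H. destruct (gtyped_shape _ _ H) as (L' & HL' & HS). inversion HL'; subst.
  inversion HS as [| | |? ? ? ? ? ? Ha|]; subst; [eauto|].
  destruct (Ha _ (or_introl eq_refl)) as (? & ? & E). discriminate E.
Qed.

(** [Theta] describes the whole session while [M] may be a part of it. Hence the agreement outside
    [D], which retypes the component that stands still in [red_par]. *)
Lemma red_session_typed M M' : red M M' -> forall Theta d D,
  coherent Theta d -> session_typed Theta D M -> NoDup D ->
  exists Theta' d' D', coherent Theta' d' /\ (forall r, ~ In r D -> Theta' r = Theta r) /\
    session_typed Theta' D' M' /\ shrinks Theta' D D'.
Proof.
  assert (Hif : forall p e P Q R Theta d D, R = P \/ R = Q ->
    coherent Theta d -> session_typed Theta D (Role p (PIf e P Q)) -> NoDup D ->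
    exists Theta' d' D', coherent Theta' d' /\ (forall r, ~ In r D -> Theta' r = Theta r) /\
      session_typed Theta' D' (Role p R) /\ shrinks Theta' D D').
  { intros p e P Q R Theta d D HR HC HD HN. exists Theta, d, D. repeat split; auto using incl_refl.
    inversion HD as [? ? HP|? ? HP|]; subst.
    - apply gtyped_if_inv in HP as [HP HQ]. constructor. destruct HR; subst; auto.
    - pose proof (nil_summands _ _ HP (summands_if _ _ _)). discriminate. }
  induction 1 as [p q l e v P bs Pj Q HI Hj He|p e P Q He|p e P Q He|M M' N HR IH
                 |M M1 M1' M' HS1 HR IH HS2]; intros Theta d D HC HD HN; eauto.
  - apply input_sum_summands in HI.
    assert (HjL : In (PIn q l Pj) (map (fun '(l, Q) => PIn q l Q) bs))
      by (apply in_map_iff; exists (l, Pj); auto).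
    inversion HD as [| |D1 D2 ? ? HD1 HD2]; subst.
    inversion HD1 as [? ? HP|? ? HP|]; subst;
      [|pose proof (nil_summands _ _ HP HI) as E; rewrite E in HjL;
        destruct HjL as [E'|[]]; discriminate E'].
    inversion HD2 as [? ? HQ|? ? HQ|]; subst;
      [|pose proof (nil_summands _ _ HQ (summands_out _ _ _ _)); discriminate].
    (* The two components have different names because the list has no duplicates. *)
    assert (Hpq : q <> p) by (inversion HN; subst; simpl in *; tauto).
    destruct (gtyped_in_inv _ _ _ _ _ _ HP HI HjL) as (bsp & HUp & HBp).
    destruct (gtyped_out_inv _ _ _ _ _ HQ) as (bsq & S & U & HUq & HBq & HeS & HQU).
    destruct (coherent_comm _ _ _ _ _ _ _ (le_n _) HC HUq HUp _ _ _ HBq)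
      as ((S' & U' & HI') & HB).
    destruct (HB _ _ HI') as (HSS & d' & HC' & _).
    destruct (HBp _ _ HI') as (S0 & HS0 & HPj).
    exists (upd2 Theta q U p U'), d', ([p] ++ [q]). repeat split; auto using incl_refl.
    + intros r Hr. apply upd2_other; intros ->; apply Hr; simpl; auto.
    + constructor; constructor.
      * rewrite upd2_snd. eapply gtyped_vsubst; eauto.
        eapply has_sort_sub; [eapply eval_preserves; eauto|]. eauto using subsort_trans.
      * rewrite upd2_fst; auto.
  - inversion HD as [| |D1 D2 ? ? HD1 HD2]; subst.
    destruct (NoDup_app_inv _ _ HN) as (HN1 & HN2 & Hd).
    destruct (IH _ _ _ HC HD1 HN1) as (Theta' & d' & D1' & HC' & Ha & HD' & HSh).
    exists Theta', d', (D1' ++ D2). repeat split; auto.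
    + intros r Hr. apply Ha. intros Hr1. apply Hr, in_app_iff; auto.
    + constructor; auto. eapply session_typed_agree; eauto.
      intros r Hr. apply Ha. intros Hr1. apply (Hd r); auto.
    + eapply shrinks_app; eauto using shrinks_refl.
    + eapply shrinks_app; eauto using shrinks_refl.
    + eapply shrinks_app; eauto using shrinks_refl.
  - destruct (proj1 (scong_session_typed _ _ HS1 Theta) _ HD HN) as (D1 & HD1 & HSh1).
    pose proof HSh1 as (HN1 & HI1 & HE1).
    destruct (IH _ _ _ HC HD1 HN1) as (Theta' & d' & D1' & HC' & Ha & HD1' & HSh').
    destruct (proj1 (scong_session_typed _ _ HS2 Theta') _ HD1' (proj1 HSh')) as (D2 & HD2 & HSh2).
    exists Theta', d', D2. split; [auto|split; [|split; auto]].
    + intros r Hr. apply Ha. auto.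
    + eapply shrinks_trans; [|eauto]. eapply shrinks_trans; [|eauto].
      (* Participants erased by the first congruence had ended in [Theta]; being outside [D1], they
         are unchanged in [Theta']. *)
      split; [|split]; auto. intros r Hr.
      destruct (in_dec Nat.eq_dec r D1) as [|Hr1]; auto. left. rewrite Ha; auto.
      destruct (HE1 r Hr); tauto.
Qed.

(** The last clause keeps everyone who still has to act inside the session, as [incl (pt G)] does
    initially. *)
Definition invariant (M : session) : Prop :=
  exists Theta d D, coherent Theta d /\ session_typed Theta D M /\ NoDup D /\
    forall p, ended (Theta p) \/ In p D.

Lemma red_invariant M M' : red M M' -> invariant M -> invariant M'.
Proof.
  intros HR (Theta & d & D & HC & HD & HN & HE).
  destruct (red_session_typed _ _ HR _ _ _ HC HD HN) as (Theta' & d' & D' & HC' & Ha & HD' & HS).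
  destruct HS as (HN' & HI & HE'). exists Theta', d', D'. repeat split; auto.
  intros p. destruct (in_dec Nat.eq_dec p D) as [Hp|Hp]; auto.
  left. rewrite Ha; auto. destruct (HE p); tauto.
Qed.

(** * Progress *)

Lemma session_typed_extract Theta D M : session_typed Theta D M -> forall p, In p D ->
  exists P N D', scong M (Par (Role p P) N) /\ gtyped [] [] P (Theta p) /\
    session_typed Theta D' N /\ forall q, In q D -> q <> p -> In q D'.
Proof.
  induction 1 as [r P HP|r P HP|D1 D2 M N H1 IH1 H2 IH2]; intros p Hp.
  (* [Role 0 PNil] stands for an empty rest; the name is arbitrary, as nobody is listed for it. *)
  - destruct Hp as [<-|[]]. exists P, (Role 0 PNil), []. repeat split; auto.
    + eapply sc_trans; [apply sc_sym, sc_nil | apply sc_comm].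
    + constructor. apply cc_refl.
    + intros q [<-|[]] Hq; congruence.
  - destruct Hp.
  - apply in_app_iff in Hp as [Hp|Hp].
    + destruct (IH1 p Hp) as (P & N' & D' & HS & HP & HN' & HD').
      exists P, (Par N' N), (D' ++ D2). repeat split; auto.
      * eapply sc_trans; [apply sc_par; [exact HS|apply sc_refl] | apply sc_assoc].
      * constructor; auto.
      * intros q Hq Hqp. rewrite in_app_iff in *. destruct Hq; auto.
    + destruct (IH2 p Hp) as (P & N' & D' & HS & HP & HN' & HD').
      exists P, (Par N' M), (D' ++ D1). repeat split; auto.
      * eapply sc_trans; [apply sc_comm|].
        eapply sc_trans; [apply sc_par; [exact HS|apply sc_refl] | apply sc_assoc].
      * constructor; auto.
      * intros q Hq Hqp. rewrite in_app_iff in *. destruct Hq; auto.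
Qed.

Lemma if_reduces p P e P1 P2 :
  summands P [PIf e P1 P2] -> etyped [] e SBool -> exists N, red (Role p P) N.
Proof.
  intros HP He. apply summands_single in HP.
  destruct (eval_total _ _ He) as (v & Hv & HS). destruct (has_sort_inv _ _ HS) as (b & ->).
  destruct b; eexists; (eapply red_struct; [apply sc_proc; exact HP | | apply sc_refl]);
  [apply red_true | apply red_false]; auto.
Qed.

Lemma red_par_r M N N' : red N N' -> red (Par M N) (Par N' M).
Proof.
  intros H. eapply red_struct; [apply sc_comm | apply red_par; eauto | apply sc_refl].
Qed.

(** A communication prefix has a type that has not ended, so each component is a conditional, which
    reduces, or congruent to [PNil]. *)
Lemma ended_progress Theta D M :
  (forall p, ended (Theta p)) -> session_typed Theta D M ->
  (exists p, scong M (Role p PNil)) \/ exists M', red M M'.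
Proof.
  intros HE. induction 1 as [p P HP|p P HP|D1 D2 M N H1 IH1 H2 IH2].
  - destruct (gtyped_shape _ _ HP) as (L & HL & HS). specialize (HE p).
    destruct HS as [T HU|q l e P' T bs S U HU|e P1 P2 T He|q L T bs HU|[] ? ? E];
      try discriminate E.
    + left. exists p. apply sc_proc, summands_single; auto.
    + destruct (not_ended_out _ _ _ HU HE).
    + right. eapply if_reduces; eauto.
    + destruct (not_ended_in _ _ _ HU HE).
  - left. exists p. apply sc_proc; auto.
  - destruct IH1 as [[p Hp]|[M' HM]]; [|right; eexists; apply red_par; eauto].
    destruct IH2 as [[q Hq]|[N' HN]]; [|right; eexists; apply red_par_r; eauto].
    left. exists q. eapply sc_trans; [apply sc_par; eauto | apply sc_nil].
Qed.

(** The root of the coherent environment names the pair to run. A conditional on either side reduces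
    by itself; otherwise the types force a single output at the sender and only inputs at the
    receiver, among them the label sent. *)
Lemma invariant_progress M :
  invariant M -> (exists p, scong M (Role p PNil)) \/ exists M', red M M'.
Proof.
  intros (Theta & d & D & HC & HD & HN & HE).
  destruct (coherent_unfold _ _ HC) as [H|(p & q & bs & bs' & Hpq & Hp & Hq & _ & H)];
    [eapply ended_progress; eauto|]. right.
  assert (HpD : In p D) by (destruct (HE p) as [E|]; auto; destruct (not_ended_out _ _ _ Hp E)).
  assert (HqD : In q D) by (destruct (HE q) as [E|]; auto; destruct (not_ended_in _ _ _ Hq E)).
  destruct (session_typed_extract _ _ _ HD p HpD) as (P & N1 & D1 & HS1 & HP & HN1 & HD1).
  destruct (session_typed_extract _ _ _ HN1 q) as (Q & N & D2 & HS2 & HQ & HN2 & _); auto.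
  assert (HSM : scong M (Par (Role p P) (Par (Role q Q) N))).
  { eapply sc_trans; [exact HS1|]. apply sc_par; [apply sc_refl | exact HS2]. }
  destruct (gtyped_shape _ _ HP) as (L & HL & HSh).
  inversion HSh as [? HU|q0 l e P' ? bs0 S U HU HI He|e P1 P2 ? He|? ? ? ? HU|[] ? ? E]; subst;
    try discriminate E;
    try (pose proof (unfolds_det _ _ Hp _ HU) as E; inversion E; subst; clear E).
  2: { destruct (if_reduces p _ _ _ _ HL He) as [N' HR]. eexists.
       eapply red_struct; [exact HSM | apply red_par; exact HR | apply sc_refl]. }
  destruct (gtyped_shape _ _ HQ) as (L' & HL' & HSh').
  inversion HSh' as [? HU'|? ? ? ? ? ? ? ? HU'|e' P1 P2 ? He'
                    |? ? ? bs1 HU' _ Ha Hex _|[] ? ? E]; subst;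
    try discriminate E;
    try (pose proof (unfolds_det _ _ Hq _ HU') as E; inversion E; subst; clear E).
  { destruct (if_reduces q0 _ _ _ _ HL' He') as [N' HR]. eexists.
    eapply red_struct; [exact HSM | apply red_par_r, red_par; exact HR | apply sc_refl]. }
  destruct (H _ _ _ HI) as ((S' & U' & HI') & _).
  destruct (Hex _ _ _ HI') as (Q' & HQ').
  (* All summands of the receiver are inputs from the sender, so congruence exposes the literal sum
     that [red_comm] needs. *)
  destruct (summands_input_sum _ _ _ HL' Ha) as (Qs & bsq & HQs & HIs & ->).
  apply in_map_iff in HQ' as ([l0 Q0] & E & HQ'). injection E as -> ->.
  destruct (eval_total _ _ He) as (v & Hv & _).
  eexists. eapply red_struct; [|apply red_par; eapply red_comm; eauto|apply sc_refl].
  eapply sc_trans; [exact HSM|]. eapply sc_trans; [apply sc_sym, sc_assoc|].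
  apply sc_par; [|apply sc_refl]. eapply sc_trans; [apply sc_comm|].
  apply sc_par; apply sc_proc; [exact HQs | apply summands_single; exact HL].
Qed.

Lemma components_typed Theta M :
  (forall p P, In (p, P) (components M) -> gtyped [] [] P (Theta p)) ->
  session_typed Theta (map fst (components M)) M.
Proof.
  induction M as [p P|M IHM N IHN]; simpl; intros H.
  - constructor; auto.
  - rewrite map_app. constructor; [apply IHM | apply IHN]; intros; apply H, in_app_iff; auto.
Qed.

(** Distinct names turn a choice per component into a function of the name, and finiteness avoids a
    choice axiom. *)
Lemma finite_choice {B} (L : list (participant * proc)) (A : participant -> proc -> B -> Prop) b0 :
  NoDup (map fst L) -> (forall p P, In (p, P) L -> exists b, A p P b) ->
  exists f, (forall p P, In (p, P) L -> A p P (f p)) /\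
    forall p, ~ In p (map fst L) -> f p = b0.
Proof.
  induction L as [|[p P] L IH]; simpl; intros HN H.
  - exists (fun _ => b0). split; auto. intros ? ? [].
  - inversion HN as [|? ? Hp HN']; subst. destruct IH as (f & Hf & Hf0); auto.
    destruct (H p P) as [b Hb]; auto. exists (fun r => if r =? p then b else f r). split.
    + intros q Q [E|HQ].
      * injection E as <- <-. rewrite Nat.eqb_refl; auto.
      * destruct (Nat.eqb_spec q p) as [->|]; auto. destruct Hp. apply (in_map fst _ _ HQ).
    + intros q Hq. destruct (Nat.eqb_spec q p) as [->|]; [tauto|]. apply Hf0; tauto.
Qed.

Lemma styped_invariant M G : guarded_session M -> styped M G -> invariant M.
Proof.
  intros HG [HW HN HT HI].
  (* A name without a component gets [TEnd] and bound 0. It does not occur in [G], whose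
     participants all have components. *)
  destruct (finite_choice (components M)
    (fun p P '(T, n) => proj p G T /\ ptyped [] [] P T /\ (~ ended T -> reach p G n))
    (TEnd, 0) HN) as (f & Hf & Hf0).
  { intros p P HP. destruct (HT p P HP) as (T & HPr & HPt).
    assert (HWT : twf 0 T) by (eapply proj_twf; eauto).
    destruct (subtype_reach _ _ _ _ HW HPr HWT (subtype_refl _ HWT)) as [n Hn].
    exists (T, n); auto. }
  assert (Hf' : forall p P, In (p, P) (components M) ->
    proj p G (fst (f p)) /\ ptyped [] [] P (fst (f p)) /\
    (~ ended (fst (f p)) -> reach p G (snd (f p)))).
  { intros p P HP. specialize (Hf p P HP). destruct (f p); auto. }
  assert (Hdom : forall p, In p (map fst (components M)) -> exists P, In (p, P) (components M)).
  { intros p Hp. apply in_map_iff in Hp as ([p' P] & <- & HP). eauto. }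
  assert (Hout : forall p, ~ In p (map fst (components M)) -> ended (fst (f p))).
  { intros p Hp. rewrite Hf0 by auto. apply unfolds_end. }
  exists (fun p => fst (f p)), (fun p => snd (f p)), (map fst (components M)).
  split; [|split; [|split]]; auto.
  - apply (projects_coherent G). split; auto. intros r.
    destruct (in_dec Nat.eq_dec r (map fst (components M))) as [Hr|Hr].
    + destruct (Hdom r Hr) as [P HP]. destruct (Hf' r P HP) as (HPr & _ & HR).
      assert (HWT : twf 0 (fst (f r))) by (eapply proj_twf; eauto).
      split; [auto|split; auto]. right. eauto using subtype_refl.
    + pose proof (Hout r Hr) as HE. split; [|split; [left; split; auto|tauto]].
      rewrite Hf0 by auto. constructor.
  - apply components_typed. intros p P HP. destruct (Hf' p P HP) as (_ & HPt & _).
    apply gtyped_intro; auto. eapply HG; eauto.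
  - intros p. destruct (in_dec Nat.eq_dec p (map fst (components M))); auto.
Qed.

Theorem mainTheorem5 (M : session) (G : gtype)
  (M_guarded : guarded_session M) (M_typed : styped M G) :
  ~ (exists M', reds M M' /\ stuck M').
Proof.
  intros (M' & HR & Hnil & Hred).
  assert (HI : invariant M').
  { pose proof (styped_invariant _ _ M_guarded M_typed) as HI. clear M_guarded M_typed Hnil Hred.
    induction HR as [M M' H|M|M M1 M' H1 IH1 H2 IH2]; eauto using red_invariant. }
  destruct (invariant_progress _ HI) as [[p Hp]|HM]; [apply (Hnil p Hp) | auto].
Qed.
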